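(* The following statement is provable in $\mathsf{RCA}_0$: for every partial order $\mathbf{P}$, $\mathbf{P}$ is a proper interval order if and only if $\mathbf{P}$ contains neither $\mathbf{2}\oplus\mathbf{2}$ nor $\mathbf{3}\oplus\mathbf{1}$.
   Context: $\mathsf{RCA}_0$ is the base subsystem of second-order arithmetic ($\Delta^0_1$ comprehension, $\Sigma^0_1$ induction). A partial order $\mathbf{P}=(P,\leq_P)$ is a set $P\subseteq\mathbb{N}$ with a reflexive, transitive, antisymmetric relation $\leq_P$; a linear order has any two elements comparable; $p<_P q$ means $p\leq_P q$ and $p\ne q$. $\mathbf{P}$ is a proper interval order if there are a linear order $\mathbf{L}=(L,\leq_L)$ and $F\subseteq P\times L$ such that, with $F(p)=\{x\in L:(p,x)\in F\}$: (i1) each $F(p)$ is nonempty and convex ($x,y\in F(p)$, $x<_L z<_L y$ imply $z\in F(p)$); (i2) $p<_P q$ iff $x<_L y$ for all $x\in F(p),y\in F(q)$; (i4) $F(p)\subseteq F(q)$ implies $F(p)=F(q)$ for all $p,q\in P$. $\mathbf{P}$ does not contain $\mathbf{2}\oplus\mathbf{2}$ if for all $p_0,q_0,p_1,q_1\in P$, $p_0<_P q_0$ and $p_1<_P q_1$ imply $p_0\leq_P q_1$ or $p_1\leq_P q_0$. $\mathbf{P}$ does not contain $\mathbf{3}\oplus\mathbf{1}$ if for all $p_0,p_1,p_2,q\in P$, $p_0<_P p_1<_P p_2$ implies $p_0\leq_P q$ or $q\leq_P p_2$. *)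

(* Defs.v *)
From Stdlib Require Import List.
Import ListNotations.

(** * The language of second-order arithmetic

    Number variables and set variables are de Bruijn indices in two independent
    index spaces: a number quantifier does not move set indices, nor conversely. *)

Inductive term : Type :=
| Var (n : nat)
| Zero
| One
| Add (s t : term)
| Mul (s t : term).

(** Equality of sets is not primitive. *)
Inductive form : Type :=
| Bot
| Eq (s t : term)
| Lt (s t : term)
| Mem (t : term) (X : nat)
| Imp (A B : form)
| And (A B : form)
| Or (A B : form)
| All (A : form)
| Ex (A : form)
| AllS (A : form)
| ExS (A : form).

Definition Neg (A : form) : form := Imp A Bot.
Definition Iff (A B : form) : form := And (Imp A B) (Imp B A).

Declare Scope form_scope.
Delimit Scope form_scope with form.
Bind Scope form_scope with form.
Notation "# n" := (Var n) (at level 1, n at level 0, format "# n") : form_scope.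
Infix "//\\" := And (at level 60, right associativity) : form_scope.
Infix "\\//" := Or (at level 62, right associativity) : form_scope.
Infix "-->" := Imp (at level 64, right associativity) : form_scope.
Infix "<-->" := Iff (at level 66, no associativity) : form_scope.
Local Open Scope form_scope.

(** ** Simultaneous substitution of terms for number variables and of set
    variables for set variables *)

Fixpoint tsubst (f : nat -> term) (t : term) : term :=
  match t with
  | Var n => f n
  | Zero => Zero
  | One => One
  | Add s t => Add (tsubst f s) (tsubst f t)
  | Mul s t => Mul (tsubst f s) (tsubst f t)
  end.

Definition scons {X : Type} (x : X) (f : nat -> X) (n : nat) : X :=
  match n with 0 => x | S k => f k end.

Definition tshift (t : term) : term := tsubst (fun n => #(S n)) t.
Definition up (f : nat -> term) : nat -> term := scons #0 (fun n => tshift (f n)).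
Definition upS (g : nat -> nat) : nat -> nat := scons 0 (fun n => S (g n)).

Fixpoint subst (f : nat -> term) (g : nat -> nat) (A : form) : form :=
  match A with
  | Bot => Bot
  | Eq s t => Eq (tsubst f s) (tsubst f t)
  | Lt s t => Lt (tsubst f s) (tsubst f t)
  | Mem t X => Mem (tsubst f t) (g X)
  | Imp A B => Imp (subst f g A) (subst f g B)
  | And A B => And (subst f g A) (subst f g B)
  | Or A B => Or (subst f g A) (subst f g B)
  | All A => All (subst (up f) g A)
  | Ex A => Ex (subst (up f) g A)
  | AllS A => AllS (subst f (upS g) A)
  | ExS A => ExS (subst f (upS g) A)
  end.

Definition shift : form -> form := subst (fun n => #(S n)) (fun X => X).
Definition shiftS : form -> form := subst Var S.
Definition inst (t : term) : form -> form := subst (scons t Var) (fun X => X).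
Definition instS (X : nat) : form -> form := subst Var (scons X (fun Y => Y)).

(** ** Classical natural deduction for two-sorted first-order logic with
    equality between numbers

    Members of the theory [T] may be used under any hypotheses [G], which
    [AllI], [ExE], [AllSI] and [ExSE] shift; so a free variable of a member of
    [T] is implicitly universally quantified. *)

Inductive prv (T : form -> Prop) : list form -> form -> Prop :=
| Ax G A : T A -> prv T G A
| Hyp G A : In A G -> prv T G A
| ImpI G A B : prv T (A :: G) B -> prv T G (A --> B)
| ImpE G A B : prv T G (A --> B) -> prv T G A -> prv T G B
| AndI G A B : prv T G A -> prv T G B -> prv T G (A //\\ B)
| AndE1 G A B : prv T G (A //\\ B) -> prv T G A
| AndE2 G A B : prv T G (A //\\ B) -> prv T G B
| OrI1 G A B : prv T G A -> prv T G (A \\// B)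
| OrI2 G A B : prv T G B -> prv T G (A \\// B)
| OrE G A B C :
    prv T G (A \\// B) -> prv T (A :: G) C -> prv T (B :: G) C -> prv T G C
| Contra G A : prv T (Neg A :: G) Bot -> prv T G A
| AllI G A : prv T (map shift G) A -> prv T G (All A)
| AllE G A t : prv T G (All A) -> prv T G (inst t A)
| ExI G A t : prv T G (inst t A) -> prv T G (Ex A)
| ExE G A B :
    prv T G (Ex A) -> prv T (A :: map shift G) (shift B) -> prv T G B
| AllSI G A : prv T (map shiftS G) A -> prv T G (AllS A)
| AllSE G A X : prv T G (AllS A) -> prv T G (instS X A)
| ExSI G A X : prv T G (instS X A) -> prv T G (ExS A)
| ExSE G A B :
    prv T G (ExS A) -> prv T (A :: map shiftS G) (shiftS B) -> prv T G B
| EqRefl G t : prv T G (Eq t t)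
| EqSubst G A s t : prv T G (Eq s t) -> prv T G (inst s A) -> prv T G (inst t A).

Definition provable (T : form -> Prop) (A : form) : Prop := prv T [] A.

(** * The system RCA_0 *)

(** Bounded-quantifier formulas; the bound is shifted because it must not
    contain the quantified variable. Number and set parameters are allowed. *)
Inductive Delta0 : form -> Prop :=
| Delta0_Bot : Delta0 Bot
| Delta0_Eq s t : Delta0 (Eq s t)
| Delta0_Lt s t : Delta0 (Lt s t)
| Delta0_Mem t X : Delta0 (Mem t X)
| Delta0_Imp A B : Delta0 A -> Delta0 B -> Delta0 (A --> B)
| Delta0_And A B : Delta0 A -> Delta0 B -> Delta0 (A //\\ B)
| Delta0_Or A B : Delta0 A -> Delta0 B -> Delta0 (A \\// B)
| Delta0_All t A : Delta0 A -> Delta0 (All (Lt #0 (tshift t) --> A))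
| Delta0_Ex t A : Delta0 A -> Delta0 (Ex (Lt #0 (tshift t) //\\ A)).

Inductive Sigma1 : form -> Prop :=
| Sigma1_Ex A : Delta0 A -> Sigma1 (Ex A).

Inductive Pi1 : form -> Prop :=
| Pi1_All A : Delta0 A -> Pi1 (All A).

Definition Succ (t : term) : term := Add t One.

(** [A] with number variable 0 replaced by its successor. *)
Definition step : form -> form :=
  subst (scons (Succ #0) (fun n => #(S n))) (fun X => X).

(** In [RCA0_induction] and [RCA0_comprehension] the distinguished variable of [A] and [B] is
    number variable 0; their other free variables are parameters. [shiftS]
    expresses that the comprehended set is not free in [A]. *)
Inductive RCA0 : form -> Prop :=
| RCA0_succ_nonzero : RCA0 (All (Neg (Eq (Succ #0) Zero)))
| RCA0_succ_inj : RCA0 (All (All (Eq (Succ #1) (Succ #0) --> Eq #1 #0)))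
| RCA0_add_zero : RCA0 (All (Eq (Add #0 Zero) #0))
| RCA0_add_succ :
    RCA0 (All (All (Eq (Add #1 (Succ #0)) (Succ (Add #1 #0)))))
| RCA0_mul_zero : RCA0 (All (Eq (Mul #0 Zero) Zero))
| RCA0_mul_succ :
    RCA0 (All (All (Eq (Mul #1 (Succ #0)) (Add (Mul #1 #0) #1))))
| RCA0_lt_zero : RCA0 (All (Neg (Lt #0 Zero)))
| RCA0_lt_succ :
    RCA0 (All (All (Lt #1 (Succ #0) <--> (Lt #1 #0 \\// Eq #1 #0))))
| RCA0_induction A :
    Sigma1 A -> RCA0 ((inst Zero A //\\ All (A --> step A)) --> All A)
| RCA0_comprehension A B :
    Sigma1 A -> Pi1 B ->
    RCA0 (All (A <--> B) --> ExS (All (Mem #0 0 <--> shiftS A))).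

(** * Orders in second-order arithmetic

    Arguments [P], [R], [L], [RL], [F] are set variables. *)

(** The usual pairing function [(s + t)^2 + s] of second-order arithmetic. *)
Definition npair (s t : term) : term := Add (Mul (Add s t) (Add s t)) s.

Definition Rel (R : nat) (s t : term) : form := Mem (npair s t) R.
Definition SRel (R : nat) (s t : term) : form := Rel R s t //\\ Neg (Eq s t).

Definition AllIn (X : nat) (A : form) : form := All (Mem #0 X --> A).
Definition ExIn (X : nat) (A : form) : form := Ex (Mem #0 X //\\ A).

(** [F] is a subset of the product of [X] and [Y]. *)
Definition SubProd (F X Y : nat) : form :=
  All (Mem #0 F --> ExIn X (ExIn Y (Eq #2 (npair #1 #0)))).

Definition PartialOrder (P R : nat) : form :=
  SubProd R P P
  //\\ AllIn P (Rel R #0 #0)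
  //\\ AllIn P (AllIn P (AllIn P (Rel R #2 #1 --> Rel R #1 #0 --> Rel R #2 #0)))
  //\\ AllIn P (AllIn P (Rel R #1 #0 --> Rel R #0 #1 --> Eq #1 #0)).

Definition LinearOrder (L RL : nat) : form :=
  PartialOrder L RL //\\ AllIn L (AllIn L (Rel RL #1 #0 \\// Rel RL #0 #1)).

(** In the convexity clause, p = #3, x = #2, y = #1, z = #0. *)
Definition NonemptyConvex (P L RL F : nat) : form :=
  AllIn P
    (ExIn L (Rel F #1 #0)
     //\\ AllIn L (AllIn L (AllIn L
            (Rel F #3 #2 --> Rel F #3 #1 -->
             SRel RL #2 #0 --> SRel RL #0 #1 --> Rel F #3 #0)))).

(** p = #1, q = #0 on the left; p = #3, q = #2, x = #1, y = #0 on the right. *)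
Definition OrderByPrecedence (P R L RL F : nat) : form :=
  AllIn P (AllIn P
    (SRel R #1 #0 <-->
     AllIn L (AllIn L (Rel F #3 #1 --> Rel F #2 #0 --> SRel RL #1 #0)))).

(** p = #2, q = #1, x = #0. *)
Definition NoProperInclusion (P L F : nat) : form :=
  AllIn P (AllIn P
    (AllIn L (Rel F #2 #0 --> Rel F #1 #0) -->
     AllIn L (Rel F #2 #0 <--> Rel F #1 #0))).

Definition ProperRepresentation (P R L RL F : nat) : form :=
  LinearOrder L RL
  //\\ SubProd F P L
  //\\ NonemptyConvex P L RL F
  //\\ OrderByPrecedence P R L RL F
  //\\ NoProperInclusion P L F.

(** The three set quantifiers bind L (index 2), its order (1) and F (0). *)
Definition ProperIntervalOrder (P R : nat) : form :=
  ExS (ExS (ExS (ProperRepresentation (3 + P) (3 + R) 2 1 0))).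

(** p0 = #3, q0 = #2, p1 = #1, q1 = #0. *)
Definition No2plus2 (P R : nat) : form :=
  AllIn P (AllIn P (AllIn P (AllIn P
    (SRel R #3 #2 --> SRel R #1 #0 --> (Rel R #3 #0 \\// Rel R #1 #2))))).

(** p0 = #3, p1 = #2, p2 = #1, q = #0. *)
Definition No3plus1 (P R : nat) : form :=
  AllIn P (AllIn P (AllIn P (AllIn P
    (SRel R #3 #2 --> SRel R #2 #1 --> (Rel R #3 #0 \\// Rel R #0 #1))))).

(* Main.v *)
(** By the completeness theorem for two-sorted first-order logic it suffices to argue in an
    arbitrary, possibly nonstandard, model of RCA_0.

    A proper representation yields both exclusions by chasing points. For the converse,
    write [p ≺ q] if some [r] satisfies [r < q], [r ≮ p] or [p < r], [q ≮ r]; in every proper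
    representation the interval of [p] then begins and ends before that of [q]. The two
    exclusions say that [≺] is a strict weak order, but [≺] is only Sigma_1, so the order of
    the endpoints cannot be decided and a representation has to be built in stages.
    A point of the line is a cut, which assigns to each element of the order one of the
    statuses "left of the point", "containing it" and "right of it". For [p < n] there are two
    points, which on the elements below [n] are the two ends of the interval of [p] as far as
    the witnesses [r < n] tell; the status of each later element [z] is defined by recursion
    as the leftmost one compatible with the earlier statuses and the witnesses [r <= z].
    Any two cuts are comparable, and cuts that agree long enough agree forever, so the line
    and the incidence relation are sets of the model. *)

From Stdlib Require Import List Arith Lia Classical ClassicalEpsilon.
From Stdlib Require Import FunctionalExtensionality PropExtensionality Ring.
From Stdlib Require Cantor.
Require Import Defs.
Import ListNotations.
Local Open Scope form_scope.

(** * Substitution *)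

Lemma tsubst_comp f g t :
  tsubst g (tsubst f t) = tsubst (fun n => tsubst g (f n)) t.
Proof. induction t; cbn; congruence. Qed.

Lemma tsubst_id t : tsubst Var t = t.
Proof. induction t; cbn; congruence. Qed.

Lemma up_Var : up Var = Var.
Proof. extensionality n. now destruct n. Qed.

Lemma upS_id : upS (fun X => X) = fun X => X.
Proof. extensionality n. now destruct n. Qed.

Lemma tsubst_up_shift f t : tsubst (up f) (tshift t) = tshift (tsubst f t).
Proof. unfold tshift. now rewrite !tsubst_comp. Qed.

Lemma up_comp f g :
  (fun n => tsubst (up g) (up f n)) = up (fun n => tsubst g (f n)).
Proof.
  extensionality n. destruct n; [reflexivity|]. apply tsubst_up_shift.
Qed.

Lemma upS_comp (f g : nat -> nat) :
  (fun n => upS g (upS f n)) = upS (fun n => g (f n)).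
Proof. extensionality n. now destruct n. Qed.

Lemma subst_comp A : forall f g f' g',
  subst f' g' (subst f g A) = subst (fun n => tsubst f' (f n)) (fun X => g' (g X)) A.
Proof.
  induction A; intros; cbn; rewrite ?tsubst_comp; f_equal; auto.
  1, 2: now rewrite IHA, up_comp.
  1, 2: now rewrite IHA, upS_comp.
Qed.

Lemma subst_id A : subst Var (fun X => X) A = A.
Proof.
  induction A; cbn; rewrite ?tsubst_id, ?up_Var, ?upS_id; congruence.
Qed.

Ltac subst_eq :=
  unfold shift, shiftS, inst, instS, step, tshift; rewrite !subst_comp; f_equal;
  let n := fresh in extensionality n; destruct n;
  cbn; unfold tshift; rewrite ?tsubst_comp; cbn; rewrite ?tsubst_id; auto.

Lemma shift_subst f g A : shift (subst f g A) = subst (up f) g (shift A).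
Proof. subst_eq. Qed.

Lemma shiftS_subst f g A : shiftS (subst f g A) = subst f (upS g) (shiftS A).
Proof. subst_eq. Qed.

Lemma subst_inst f g t A :
  subst f g (inst t A) = inst (tsubst f t) (subst (up f) g A).
Proof. subst_eq. Qed.

Lemma subst_instS f g X A :
  subst f g (instS X A) = instS (g X) (subst f (upS g) A).
Proof. subst_eq. Qed.

Lemma inst_up f g t A : inst t (subst (up f) g A) = subst (scons t f) g A.
Proof. subst_eq. Qed.

Lemma instS_upS f g X A : instS X (subst f (upS g) A) = subst f (scons X g) A.
Proof. subst_eq. Qed.

Lemma subst_step f g A : subst (up f) g (step A) = step (subst (up f) g A).
Proof. subst_eq. Qed.

(** * Derivations *)

Definition subst_closed (T : form -> Prop) : Prop :=
  forall A f g, T A -> T (subst f g A).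

Section Derivations.

Variable T : form -> Prop.
Hypothesis T_closed : subst_closed T.

Lemma map_shift_subst f g G :
  map (subst (up f) g) (map shift G) = map shift (map (subst f g) G).
Proof. rewrite !map_map. apply map_ext. intros; now rewrite shift_subst. Qed.

Lemma map_shiftS_subst f g G :
  map (subst f (upS g)) (map shiftS G) = map shiftS (map (subst f g) G).
Proof. rewrite !map_map. apply map_ext. intros; now rewrite shiftS_subst. Qed.

Lemma prv_subst G A f g :
  prv T G A -> prv T (map (subst f g) G) (subst f g A).
Proof.
  intros H; revert f g.
  induction H; intros f g; cbn in *; rewrite ?subst_inst, ?subst_instS in *.
  - apply Ax. auto.
  - apply Hyp. now apply in_map.
  - apply ImpI. apply IHprv.
  - eapply ImpE; eauto.
  - apply AndI; auto.
  - eapply AndE1; eauto.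
  - eapply AndE2; eauto.
  - apply OrI1; auto.
  - apply OrI2; auto.
  - eapply OrE; eauto.
  - apply Contra. apply IHprv.
  - apply AllI. rewrite <- map_shift_subst. apply IHprv.
  - apply AllE. apply IHprv.
  - eapply ExI. rewrite <- subst_inst. apply IHprv.
  - eapply ExE; [apply IHprv1|].
    rewrite shift_subst, <- map_shift_subst. apply IHprv2.
  - apply AllSI. rewrite <- map_shiftS_subst. apply IHprv.
  - apply AllSE. apply IHprv.
  - eapply ExSI. rewrite <- subst_instS. apply IHprv.
  - eapply ExSE; [apply IHprv1|].
    rewrite shiftS_subst, <- map_shiftS_subst. apply IHprv2.
  - apply EqRefl.
  - eapply EqSubst; [apply IHprv1|]. rewrite <- subst_inst. apply IHprv2.
Qed.

Lemma incl_cons_same (X : Type) (a : X) G G' :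
  incl G G' -> incl (a :: G) (a :: G').
Proof. intros H b [->|Hb]; [now left|right; auto]. Qed.

Lemma prv_weaken G A : prv T G A -> forall G', incl G G' -> prv T G' A.
Proof.
  induction 1; intros G' HG;
    try (econstructor; eauto using incl_cons_same, incl_map; fail).
Qed.

Definition consistent (G : list form) : Prop := ~ prv T G Bot.

Lemma consistent_cons_of_prv G G' A :
  consistent G' -> incl G G' -> prv T G' A -> consistent (A :: G).
Proof.
  intros HG' Hi HA HG. apply HG'. eapply ImpE; [|exact HA].
  apply ImpI. eapply prv_weaken; [exact HG|]. now apply incl_cons_same.
Qed.

Lemma tsubst_finite t : exists n, forall f f',
  (forall i, i < n -> f i = f' i) -> tsubst f t = tsubst f' t.
Proof.
  induction t as [i| | |s [n Hn] t [m Hm]|s [n Hn] t [m Hm]].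
  - exists (S i). intros f f' H. cbn. apply H. lia.
  - now exists 0.
  - now exists 0.
  - exists (n + m). intros f f' H. cbn. f_equal; [apply Hn|apply Hm]; intros; apply H; lia.
  - exists (n + m). intros f f' H. cbn. f_equal; [apply Hn|apply Hm]; intros; apply H; lia.
Qed.

Definition vars_below (k : nat) (A : form) : Prop :=
  forall f f' g g', (forall i, i < k -> f i = f' i) -> (forall i, i < k -> g i = g' i) ->
  subst f g A = subst f' g' A.

Lemma vars_below_le k k' A : vars_below k A -> k <= k' -> vars_below k' A.
Proof. intros H Hk f f' g g' Hf Hg. apply H; intros; [apply Hf|apply Hg]; lia. Qed.

Lemma vars_below_ex A : exists k, vars_below k A.
Proof.
  induction A as [|s t|s t|t X|A [n Hn] B [m Hm]|A [n Hn] B [m Hm]|A [n Hn] B [m Hm]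
                  |A [n Hn]|A [n Hn]|A [n Hn]|A [n Hn]].
  - now exists 0.
  - destruct (tsubst_finite s) as [n Hn], (tsubst_finite t) as [m Hm].
    exists (n + m). intros f f' g g' Hf Hg. cbn.
    f_equal; [apply Hn|apply Hm]; intros; apply Hf; lia.
  - destruct (tsubst_finite s) as [n Hn], (tsubst_finite t) as [m Hm].
    exists (n + m). intros f f' g g' Hf Hg. cbn.
    f_equal; [apply Hn|apply Hm]; intros; apply Hf; lia.
  - destruct (tsubst_finite t) as [m Hm].
    exists (S X + m). intros f f' g g' Hf Hg. cbn.
    f_equal; [apply Hm; intros; apply Hf|apply Hg]; lia.
  - exists (n + m). intros f f' g g' Hf Hg. cbn.
    f_equal; [apply Hn|apply Hm]; intros; apply Hf || apply Hg; lia.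
  - exists (n + m). intros f f' g g' Hf Hg. cbn.
    f_equal; [apply Hn|apply Hm]; intros; apply Hf || apply Hg; lia.
  - exists (n + m). intros f f' g g' Hf Hg. cbn.
    f_equal; [apply Hn|apply Hm]; intros; apply Hf || apply Hg; lia.
  - exists n. intros f f' g g' Hf Hg. cbn. f_equal. apply Hn; [|exact Hg].
    intros [|i] Hi; cbn; [reflexivity|]. rewrite Hf; [reflexivity|lia].
  - exists n. intros f f' g g' Hf Hg. cbn. f_equal. apply Hn; [|exact Hg].
    intros [|i] Hi; cbn; [reflexivity|]. rewrite Hf; [reflexivity|lia].
  - exists n. intros f f' g g' Hf Hg. cbn. f_equal. apply Hn; [exact Hf|].
    intros [|i] Hi; cbn; [reflexivity|]. rewrite Hg; [reflexivity|lia].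
  - exists n. intros f f' g g' Hf Hg. cbn. f_equal. apply Hn; [exact Hf|].
    intros [|i] Hi; cbn; [reflexivity|]. rewrite Hg; [reflexivity|lia].
Qed.

Lemma vars_below_list G : exists k, forall A, In A G -> vars_below k A.
Proof.
  induction G as [|A G [m Hm]].
  - exists 0. intros A [].
  - destruct (vars_below_ex A) as [n Hn]. exists (n + m).
    intros B [<-|HB].
    + apply vars_below_le with n; [assumption|lia].
    + apply vars_below_le with m; [auto|lia].
Qed.

(** Variables not occurring in the finite context play the part of Henkin constants. *)
Lemma consistent_witness G B :
  consistent G -> In (Ex B) G -> exists t, consistent (inst t B :: G).
Proof.
  intros HG HB. destruct (vars_below_list (B :: G)) as [k Hk].
  exists #k. intros H. apply HG.
  set (f i := if i =? k then #0 else #(S i)).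
  apply (prv_subst _ _ f (fun X => X)) in H. cbn in H.
  eapply ExE; [apply Hyp, HB|].
  enough (HBf : subst f (fun X => X) (inst #k B) = B).
  { rewrite HBf in H. erewrite map_ext_in in H; [exact H|].
    intros A HA. apply (Hk A); [now right| |reflexivity].
    intros i Hi. unfold f. destruct (Nat.eqb_spec i k); [lia|reflexivity]. }
  unfold inst. rewrite subst_comp. rewrite <- (subst_id B) at 2.
  apply (Hk B); [now left| |reflexivity].
  intros [|i] Hi; cbn; unfold f.
  - now rewrite Nat.eqb_refl.
  - destruct (Nat.eqb_spec i k); [lia|reflexivity].
Qed.

Lemma consistent_witnessS G B :
  consistent G -> In (ExS B) G -> exists X, consistent (instS X B :: G).
Proof.
  intros HG HB. destruct (vars_below_list (B :: G)) as [k Hk].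
  exists k. intros H. apply HG.
  set (g i := if i =? k then 0 else S i).
  apply (prv_subst _ _ Var g) in H. cbn in H.
  eapply ExSE; [apply Hyp, HB|].
  enough (HBf : subst Var g (instS k B) = B).
  { rewrite HBf in H. erewrite map_ext_in in H; [exact H|].
    intros A HA. apply (Hk A); [now right|reflexivity|].
    intros i Hi. unfold g. destruct (Nat.eqb_spec i k); [lia|reflexivity]. }
  unfold instS. rewrite subst_comp. rewrite <- (subst_id B) at 2.
  apply (Hk B); [now left|reflexivity|].
  intros [|i] Hi; cbn; unfold g.
  - now rewrite Nat.eqb_refl.
  - destruct (Nat.eqb_spec i k); [lia|reflexivity].
Qed.

Definition henkin_step (A : form) (G G' : list form) : Prop :=
  incl G G' /\ consistent G' /\
  (consistent (A :: G) -> In A G' /\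
     (forall B, A = Ex B -> exists t, In (inst t B) G') /\
     (forall B, A = ExS B -> exists X, In (instS X B) G')).

Lemma henkin_step_ex A G : exists G', consistent G -> henkin_step A G G'.
Proof.
  destruct (classic (consistent (A :: G))) as [HA|HA].
  2: { exists G. intros HG. repeat split; auto using incl_refl; tauto. }
  assert (Hdone : (forall B, A <> Ex B) -> (forall B, A <> ExS B) ->
            exists G', consistent G -> henkin_step A G G').
  { intros H1 H2. exists (A :: G). intros HG. split; [apply incl_tl, incl_refl|].
    split; [exact HA|]. intros _. split; [now left|].
    split; intros B E; [destruct (H1 B E)|destruct (H2 B E)]. }
  destruct A as [|s t|s t|t X|A B|A B|A B|B|B|B|B]; try (apply Hdone; discriminate).
  - destruct (consistent_witness (Ex B :: G) B) as [t Ht]; [exact HA|now left|].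
    exists (inst t B :: Ex B :: G). intros HG.
    split; [now apply incl_tl, incl_tl, incl_refl|]. split; [exact Ht|].
    intros _. split; [right; now left|]. split; intros B' E; [|discriminate].
    injection E as <-. exists t. now left.
  - destruct (consistent_witnessS (ExS B :: G) B) as [X HX]; [exact HA|now left|].
    exists (instS X B :: ExS B :: G). intros HG.
    split; [now apply incl_tl, incl_tl, incl_refl|]. split; [exact HX|].
    intros _. split; [right; now left|]. split; intros B' E; [discriminate|].
    injection E as <-. exists X. now left.
Qed.

End Derivations.

(** * Completeness *)

Fixpoint tcode (t : term) : nat :=
  match t with
  | Var n => Cantor.to_nat (0, n)
  | Zero => Cantor.to_nat (1, 0)
  | One => Cantor.to_nat (2, 0)
  | Add s t => Cantor.to_nat (3, Cantor.to_nat (tcode s, tcode t))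
  | Mul s t => Cantor.to_nat (4, Cantor.to_nat (tcode s, tcode t))
  end.

Fixpoint fcode (A : form) : nat :=
  match A with
  | Bot => Cantor.to_nat (0, 0)
  | Eq s t => Cantor.to_nat (1, Cantor.to_nat (tcode s, tcode t))
  | Lt s t => Cantor.to_nat (2, Cantor.to_nat (tcode s, tcode t))
  | Mem t X => Cantor.to_nat (3, Cantor.to_nat (tcode t, X))
  | Imp A B => Cantor.to_nat (4, Cantor.to_nat (fcode A, fcode B))
  | And A B => Cantor.to_nat (5, Cantor.to_nat (fcode A, fcode B))
  | Or A B => Cantor.to_nat (6, Cantor.to_nat (fcode A, fcode B))
  | All A => Cantor.to_nat (7, fcode A)
  | Ex A => Cantor.to_nat (8, fcode A)
  | AllS A => Cantor.to_nat (9, fcode A)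
  | ExS A => Cantor.to_nat (10, fcode A)
  end.

Ltac split_code :=
  repeat match goal with
  | H : Cantor.to_nat _ = Cantor.to_nat _ |- _ => apply Cantor.to_nat_inj in H
  | H : (_, _) = (_, _) |- _ => apply pair_equal_spec in H; destruct H
  end.

Lemma tcode_inj s : forall t, tcode s = tcode t -> s = t.
Proof.
  induction s; intros []; cbn [tcode]; intros H; split_code;
    try discriminate; f_equal; auto.
Qed.

Lemma fcode_inj A : forall B, fcode A = fcode B -> A = B.
Proof.
  induction A; intros []; cbn [fcode]; intros H; split_code;
    try discriminate; f_equal; auto using tcode_inj.
Qed.

Definition fdecode (n : nat) : form := epsilon (inhabits Bot) (fun A => fcode A = n).

Lemma fdecode_fcode A : fdecode (fcode A) = A.
Proof.
  apply fcode_inj. unfold fdecode.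
  apply (epsilon_spec (inhabits Bot) (fun B => fcode B = fcode A)). now exists A.
Qed.

Record structure : Type := {
  num :> Type;
  nzero : num;
  none : num;
  nadd : num -> num -> num;
  nmul : num -> num -> num;
  nlt : num -> num -> Prop;
  sets : Type;
  nmem : num -> sets -> Prop }.

Arguments nadd {_} _ _.
Arguments nmul {_} _ _.
Arguments nlt {_} _ _.
Arguments nmem {_} _ _.

Fixpoint eval (M : structure) (r : nat -> M) (t : term) : M :=
  match t with
  | Var n => r n
  | Zero => nzero M
  | One => none M
  | Add s t => nadd (eval M r s) (eval M r t)
  | Mul s t => nmul (eval M r s) (eval M r t)
  end.

Fixpoint sat (M : structure) (r : nat -> M) (e : nat -> sets M) (A : form) : Prop :=
  match A with
  | Bot => False
  | Eq s t => eval M r s = eval M r t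
  | Lt s t => nlt (eval M r s) (eval M r t)
  | Mem t X => nmem (eval M r t) (e X)
  | Imp A B => sat M r e A -> sat M r e B
  | And A B => sat M r e A /\ sat M r e B
  | Or A B => sat M r e A \/ sat M r e B
  | All A => forall x, sat M (scons x r) e A
  | Ex A => exists x, sat M (scons x r) e A
  | AllS A => forall X, sat M r (scons X e) A
  | ExS A => exists X, sat M r (scons X e) A
  end.

Definition models (M : structure) (T : form -> Prop) : Prop :=
  forall A r e, T A -> sat M r e A.

Section Completeness.

Variable T : form -> Prop.
Hypothesis T_closed : subst_closed T.
Variable A0 : form.
Hypothesis A0_unprovable : ~ prv T [] A0.

Fixpoint ctx (n : nat) : list form :=
  match n with
  | 0 => [Neg A0]
  | S n => epsilon (inhabits []) (henkin_step T (fdecode n) (ctx n))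
  end.

Lemma ctx_spec n :
  consistent T (ctx n) /\ henkin_step T (fdecode n) (ctx n) (ctx (S n)).
Proof.
  assert (Hs : consistent T (ctx n) -> henkin_step T (fdecode n) (ctx n) (ctx (S n))).
  { intros H. cbn. apply epsilon_spec.
    destruct (henkin_step_ex T T_closed (fdecode n) (ctx n)) as [G' HG']. eauto. }
  enough (consistent T (ctx n)) by auto.
  clear Hs. induction n as [|n IH].
  - intros H. apply A0_unprovable. now apply Contra.
  - assert (H : henkin_step T (fdecode n) (ctx n) (ctx (S n))); [|apply H].
    cbn. apply epsilon_spec.
    destruct (henkin_step_ex T T_closed (fdecode n) (ctx n)) as [G' HG']. eauto.
Qed.

Lemma ctx_mono n m : n <= m -> incl (ctx n) (ctx m).
Proof.
  induction 1; [apply incl_refl|].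
  eapply incl_tran; [eassumption|]. apply ctx_spec.
Qed.

Definition Th (A : form) : Prop := exists n, In A (ctx n).

Lemma ctx_added A n : prv T (ctx n) A -> consistent T (A :: ctx (fcode A)).
Proof.
  intros H. apply consistent_cons_of_prv with (ctx (n + fcode A)).
  - apply ctx_spec.
  - apply ctx_mono. lia.
  - eapply prv_weaken; [exact H|]. apply ctx_mono. lia.
Qed.

Lemma Th_prv n A : prv T (ctx n) A -> Th A.
Proof.
  intros H. exists (S (fcode A)).
  destruct (ctx_spec (fcode A)) as [_ (_ & _ & Hs)].
  rewrite fdecode_fcode in Hs. apply Hs. eapply ctx_added; eauto.
Qed.

Lemma Th_list G : (forall A, In A G -> Th A) -> exists n, incl G (ctx n).
Proof.
  induction G as [|A G IH]; intros H.
  - exists 0. intros A [].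
  - destruct IH as [n Hn]; [intros; apply H; now right|].
    destruct (H A) as [m Hm]; [now left|].
    exists (n + m). intros B [<-|HB].
    + eapply ctx_mono; [|exact Hm]. lia.
    + eapply ctx_mono; [|apply Hn, HB]. lia.
Qed.

Lemma Th_closed G A : prv T G A -> (forall B, In B G -> Th B) -> Th A.
Proof.
  intros H HG. destruct (Th_list G HG) as [n Hn].
  apply Th_prv with n. now apply prv_weaken with G.
Qed.

Lemma Th_Bot : ~ Th Bot.
Proof. intros [n Hn]. apply (proj1 (ctx_spec n)). now apply Hyp. Qed.

Lemma Th_Imp A B : Th (A --> B) <-> (Th A -> Th B).
Proof.
  split.
  - intros HAB HA. apply Th_closed with [A --> B; A].
    + eapply ImpE; apply Hyp; cbn; auto.
    + intros C [<-|[<-|[]]]; auto.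
  - intros H. destruct (classic (Th A)) as [HA|HA].
    + apply Th_closed with [B]; [apply ImpI, Hyp; cbn; auto|].
      intros C [<-|[]]; auto.
    + destruct (classic (consistent T (A :: ctx (fcode A)))) as [Hc|Hc].
      * destruct (ctx_spec (fcode A)) as [_ (_ & _ & Hs)].
        rewrite fdecode_fcode in Hs. destruct HA. eexists. apply (Hs Hc).
      * apply NNPP in Hc. apply Th_prv with (fcode A). apply ImpI, Contra.
        eapply prv_weaken; [exact Hc|]. apply incl_tl, incl_refl.
Qed.

Lemma Th_Neg A : Th (Neg A) <-> ~ Th A.
Proof. unfold Neg. rewrite Th_Imp. pose proof Th_Bot. tauto. Qed.

Lemma Th_And A B : Th (A //\\ B) <-> Th A /\ Th B.
Proof.
  split.
  - intros H. split; (apply Th_closed with [A //\\ B]; [|intros C [<-|[]]; auto]).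
    + eapply AndE1, Hyp; cbn; auto.
    + eapply AndE2, Hyp; cbn; auto.
  - intros [HA HB]. apply Th_closed with [A; B].
    + apply AndI; apply Hyp; cbn; auto.
    + intros C [<-|[<-|[]]]; auto.
Qed.

Lemma Th_Or A B : Th (A \\// B) <-> Th A \/ Th B.
Proof.
  split.
  - intros H. apply NNPP. intros Hn. apply Th_Bot.
    apply Th_closed with [A \\// B; Neg A; Neg B].
    + eapply OrE; [apply Hyp; cbn; auto| |].
      * eapply ImpE; [apply Hyp with (A := Neg A)|apply Hyp]; cbn; auto.
      * eapply ImpE; [apply Hyp with (A := Neg B)|apply Hyp]; cbn; auto.
    + intros C [<-|[<-|[<-|[]]]]; [auto|apply Th_Neg..]; tauto.
  - intros [H|H].
    + apply Th_closed with [A]; [apply OrI1, Hyp; cbn; auto|].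
      intros C [<-|[]]; auto.
    + apply Th_closed with [B]; [apply OrI2, Hyp; cbn; auto|].
      intros C [<-|[]]; auto.
Qed.

Lemma Th_Ex A : Th (Ex A) <-> exists t, Th (inst t A).
Proof.
  split.
  - intros [n Hn]. destruct (ctx_spec (fcode (Ex A))) as [_ (_ & _ & Hs)].
    rewrite fdecode_fcode in Hs.
    destruct (proj1 (proj2 (Hs (ctx_added _ _ (Hyp _ _ _ Hn)))) A eq_refl) as [t Ht].
    exists t. eexists. exact Ht.
  - intros [t Ht]. apply Th_closed with [inst t A].
    + apply ExI with t, Hyp. cbn; auto.
    + intros C [<-|[]]; auto.
Qed.

Lemma Th_ExS A : Th (ExS A) <-> exists X, Th (instS X A).
Proof.
  split.
  - intros [n Hn]. destruct (ctx_spec (fcode (ExS A))) as [_ (_ & _ & Hs)].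
    rewrite fdecode_fcode in Hs.
    destruct (proj2 (proj2 (Hs (ctx_added _ _ (Hyp _ _ _ Hn)))) A eq_refl) as [X HX].
    exists X. eexists. exact HX.
  - intros [X HX]. apply Th_closed with [instS X A].
    + apply ExSI with X, Hyp. cbn; auto.
    + intros C [<-|[]]; auto.
Qed.

Lemma Th_All A : Th (All A) <-> forall t, Th (inst t A).
Proof.
  split.
  - intros H t. apply Th_closed with [All A].
    + apply AllE, Hyp. cbn; auto.
    + intros C [<-|[]]; auto.
  - intros H. apply NNPP. intros Hn. apply Th_Neg in Hn.
    assert (HE : Th (Ex (Neg A))).
    { apply Th_closed with [Neg (All A)]; [|intros C [<-|[]]; auto].
      apply Contra. eapply ImpE; [apply Hyp; right; now left|].
      apply AllI, Contra. cbn.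
      eapply ImpE; [apply Hyp; right; now left|].
      apply ExI with #0.
      change (prv T [Neg A; shift (Neg (Ex (Neg A))); shift (Neg (All A))]
                (inst #0 (subst (up (fun n => #(S n))) (fun X => X) (Neg A)))).
      apply Hyp. left. rewrite inst_up. rewrite <- (subst_id (Neg A)) at 1.
      f_equal. extensionality n. now destruct n. }
    apply Th_Ex in HE. destruct HE as [t Ht].
    apply (proj1 (Th_Neg _) Ht), H.
Qed.

Lemma Th_AllS A : Th (AllS A) <-> forall X, Th (instS X A).
Proof.
  split.
  - intros H X. apply Th_closed with [AllS A].
    + apply AllSE, Hyp. cbn; auto.
    + intros C [<-|[]]; auto.
  - intros H. apply NNPP. intros Hn. apply Th_Neg in Hn.
    assert (HE : Th (ExS (Neg A))).
    { apply Th_closed with [Neg (AllS A)]; [|intros C [<-|[]]; auto].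
      apply Contra. eapply ImpE; [apply Hyp; right; now left|].
      apply AllSI, Contra. cbn.
      eapply ImpE; [apply Hyp; right; now left|].
      apply ExSI with 0.
      change (prv T [Neg A; shiftS (Neg (ExS (Neg A))); shiftS (Neg (AllS A))]
                (instS 0 (subst Var (upS S) (Neg A)))).
      apply Hyp. left. rewrite instS_upS. rewrite <- (subst_id (Neg A)) at 1.
      f_equal. extensionality n. now destruct n. }
    apply Th_ExS in HE. destruct HE as [X HX].
    apply (proj1 (Th_Neg _) HX), H.
Qed.

Lemma Th_Eq_refl t : Th (Eq t t).
Proof. apply Th_closed with []; [apply EqRefl|intros _ []]. Qed.

Lemma Th_Eq_subst A s t : Th (Eq s t) -> Th (inst s A) -> Th (inst t A).
Proof.
  intros H1 H2. apply Th_closed with [Eq s t; inst s A].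
  - eapply EqSubst; apply Hyp; cbn; auto.
  - intros C [<-|[<-|[]]]; auto.
Qed.

Lemma tsubst_shift_inst s t : tsubst (scons t Var) (tshift s) = s.
Proof. unfold tshift. rewrite tsubst_comp. apply tsubst_id. Qed.

Lemma Th_Eq_sym s t : Th (Eq s t) -> Th (Eq t s).
Proof.
  intros H.
  assert (Hs := Th_Eq_subst (Eq #0 (tshift s)) s t H).
  cbn in Hs. rewrite !tsubst_shift_inst in Hs. apply Hs, Th_Eq_refl.
Qed.

Lemma Th_Eq_trans s t u : Th (Eq s t) -> Th (Eq t u) -> Th (Eq s u).
Proof.
  intros H1 H2.
  assert (Hs := Th_Eq_subst (Eq (tshift s) #0) t u H2).
  cbn in Hs. rewrite !tsubst_shift_inst in Hs. auto.
Qed.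

Definition rep (t : term) : term := epsilon (inhabits Zero) (fun s => Th (Eq t s)).

Lemma Th_rep t : Th (Eq t (rep t)).
Proof. unfold rep. apply epsilon_spec. exists t. apply Th_Eq_refl. Qed.

Lemma rep_eq s t : rep s = rep t <-> Th (Eq s t).
Proof.
  split.
  - intros H. apply Th_Eq_trans with (rep s); [apply Th_rep|].
    rewrite H. apply Th_Eq_sym, Th_rep.
  - intros H. unfold rep. f_equal. extensionality u.
    apply propositional_extensionality. split; intros Hu.
    + apply Th_Eq_trans with s; [now apply Th_Eq_sym|assumption].
    + now apply Th_Eq_trans with t.
Qed.

Lemma rep_rep t : rep (rep t) = rep t.
Proof. apply rep_eq, Th_Eq_sym, Th_rep. Qed.

Definition tnum : Type := {t : term | rep t = t}.

Definition cls (t : term) : tnum := exist _ (rep t) (rep_rep t).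

Lemma tnum_eq (x y : tnum) : proj1_sig x = proj1_sig y -> x = y.
Proof. apply eq_sig_hprop. intros; apply proof_irrelevance. Qed.

Lemma cls_eq s t : cls s = cls t <-> Th (Eq s t).
Proof.
  rewrite <- rep_eq. split.
  - intros H. now injection H.
  - intros H. now apply tnum_eq.
Qed.

Lemma cls_val (x : tnum) : cls (proj1_sig x) = x.
Proof. apply tnum_eq. apply (proj2_sig x). Qed.

Definition term_model : structure := {|
  num := tnum;
  nzero := cls Zero;
  none := cls One;
  nadd x y := cls (Add (proj1_sig x) (proj1_sig y));
  nmul x y := cls (Mul (proj1_sig x) (proj1_sig y));
  nlt x y := Th (Lt (proj1_sig x) (proj1_sig y));
  sets := nat;
  nmem x X := Th (Mem (proj1_sig x) X) |}.

Lemma Th_congr2 (o : term -> term -> form) s s' t t' :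
  (forall f a b, subst f (fun X => X) (o a b) = o (tsubst f a) (tsubst f b)) ->
  Th (Eq s s') -> Th (Eq t t') -> Th (o s t) -> Th (o s' t').
Proof.
  intros Ho Hs Ht H.
  assert (H1 := Th_Eq_subst (o #0 (tshift t)) s s' Hs).
  assert (H2 := Th_Eq_subst (o (tshift s') #0) t t' Ht).
  unfold inst in *. rewrite !Ho in *. cbn in *. rewrite !tsubst_shift_inst in *. auto.
Qed.

Lemma Th_eq_congr2 (o : term -> term -> term) s s' t t' :
  (forall f a b, tsubst f (o a b) = o (tsubst f a) (tsubst f b)) ->
  Th (Eq s s') -> Th (Eq t t') -> Th (Eq (o s t) (o s' t')).
Proof.
  intros Ho Hs Ht.
  assert (H1 := Th_Eq_subst (Eq (tshift (o s t)) (o #0 (tshift t))) s s' Hs).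
  assert (H2 := Th_Eq_subst (Eq (tshift (o s t)) (o (tshift s') #0)) t t' Ht).
  unfold inst in *. cbn in *. rewrite !Ho in *. cbn in *.
  rewrite !tsubst_shift_inst in *. auto using Th_Eq_refl.
Qed.

Lemma eval_cls f t : eval term_model (fun n => cls (f n)) t = cls (tsubst f t).
Proof.
  induction t as [n| | |s IHs t IHt|s IHs t IHt]; cbn; try reflexivity.
  - rewrite IHs, IHt. apply cls_eq.
    apply Th_eq_congr2; [reflexivity|apply Th_Eq_sym, Th_rep..].
  - rewrite IHs, IHt. apply cls_eq.
    apply Th_eq_congr2; [reflexivity|apply Th_Eq_sym, Th_rep..].
Qed.

Lemma scons_cls f x :
  scons x (fun n => cls (f n)) = fun n => cls (scons (proj1_sig x) f n).
Proof. extensionality n. destruct n; cbn; [now rewrite cls_val|reflexivity]. Qed.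

Lemma truth A : forall f g,
  sat term_model (fun n => cls (f n)) g A <-> Th (subst f g A).
Proof.
  induction A as [|s t|s t|t X|A IHA B IHB|A IHA B IHB|A IHA B IHB
                  |A IH|A IH|A IH|A IH]; intros f g; cbn [sat subst].
  - pose proof Th_Bot. tauto.
  - rewrite !eval_cls. apply cls_eq.
  - rewrite !eval_cls. cbn. split; apply Th_congr2;
      try reflexivity; try apply Th_rep; apply Th_Eq_sym, Th_rep.
  - rewrite !eval_cls. cbn. split; apply (Th_congr2 (fun a _ => Mem a (g X)) _ _ Zero Zero);
      try reflexivity; try apply Th_Eq_refl; try apply Th_rep; apply Th_Eq_sym, Th_rep.
  - now rewrite IHA, IHB, Th_Imp.
  - now rewrite IHA, IHB, Th_And.
  - now rewrite IHA, IHB, Th_Or.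
  - rewrite Th_All. split.
    + intros H t. rewrite inst_up. apply IH.
      assert (E : (fun n => cls (scons t f n)) = scons (cls t) (fun n => cls (f n))).
      { extensionality n. now destruct n. }
      rewrite E. apply H.
    + intros H x. rewrite scons_cls. apply IH. rewrite <- inst_up. apply H.
  - rewrite Th_Ex. split.
    + intros [x H]. rewrite scons_cls in H. exists (proj1_sig x).
      rewrite inst_up. now apply IH.
    + intros [t H]. rewrite inst_up in H. apply IH in H. exists (cls t).
      assert (E : (fun n => cls (scons t f n)) = scons (cls t) (fun n => cls (f n))).
      { extensionality n. now destruct n. }
      change (sat term_model (scons (cls t) (fun n => cls (f n))) g A).
      now rewrite <- E.
  - rewrite Th_AllS. split; intros H X; specialize (H X).
    + rewrite instS_upS. now apply IH.
    + rewrite instS_upS in H. now apply IH.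
  - rewrite Th_ExS. split; intros [X H]; exists X.
    + rewrite instS_upS. now apply IH.
    + rewrite instS_upS in H. now apply IH.
Qed.

Lemma term_model_models : models term_model T.
Proof.
  intros A r e HA.
  replace r with (fun n => cls (proj1_sig (r n))).
  - apply truth. apply Th_prv with 0. apply Ax. now apply T_closed.
  - extensionality n. apply cls_val.
Qed.

Lemma term_model_refutes : ~ sat term_model (fun n => cls #n) (fun X => X) A0.
Proof.
  rewrite truth, subst_id. apply Th_Neg. exists 0. now left.
Qed.

End Completeness.

Theorem completeness T A :
  subst_closed T -> (forall M, models M T -> forall r e, sat M r e A) -> provable T A.
Proof.
  intros HT H. apply NNPP. intros HA.
  apply (term_model_refutes T HT A HA). apply H, (term_model_models T HT A HA).
Qed.

Lemma Delta0_subst A : Delta0 A -> forall f g, Delta0 (subst f g A).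
Proof.
  induction 1; intros f g; cbn; try (constructor; auto; fail).
  - rewrite tsubst_up_shift. now apply Delta0_All.
  - rewrite tsubst_up_shift. now apply Delta0_Ex.
Qed.

Lemma RCA0_closed : subst_closed RCA0.
Proof.
  intros A f g H. destruct H as [| | | | | | | |A HA|A B HA HB]; try (cbn; constructor).
  - cbn. rewrite subst_inst, subst_step. apply RCA0_induction.
    destruct HA. cbn. constructor. now apply Delta0_subst.
  - assert (E : subst (up f) (upS g) (shiftS A) = shiftS (subst (up f) g A))
      by (symmetry; apply shiftS_subst).
    cbn. rewrite E. apply (RCA0_comprehension (subst (up f) g A) (subst (up f) g B)).
    + destruct HA. cbn. constructor. now apply Delta0_subst.
    + destruct HB. cbn. constructor. now apply Delta0_subst.
Qed.

(** * Arithmetic and comprehension in models of RCA_0 *)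

Lemma eval_tsubst M r f t : eval M r (tsubst f t) = eval M (fun n => eval M r (f n)) t.
Proof. induction t; cbn; congruence. Qed.

Lemma eval_up M r f x :
  (fun n => eval M (scons x r) (up f n)) = scons x (fun n => eval M r (f n)).
Proof.
  extensionality n. destruct n; [reflexivity|]. cbn. unfold tshift. now rewrite eval_tsubst.
Qed.

Lemma scons_upS (M : structure) (e : nat -> sets M) g X :
  (fun n => scons X e (upS g n)) = scons X (fun n => e (g n)).
Proof. extensionality n. now destruct n. Qed.

Lemma sat_subst M A : forall r e f g,
  sat M r e (subst f g A) <-> sat M (fun n => eval M r (f n)) (fun X => e (g X)) A.
Proof.
  induction A as [|s t|s t|t X|A IHA B IHB|A IHA B IHB|A IHA B IHB
                  |A IH|A IH|A IH|A IH]; intros r e f g; cbn; rewrite ?eval_tsubst.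
  1-4: reflexivity.
  1-3: now rewrite IHA, IHB.
  - split; intros H x; specialize (H x);
      [rewrite IH, eval_up in H|rewrite IH, eval_up]; exact H.
  - split; intros [x H]; exists x;
      [rewrite IH, eval_up in H|rewrite IH, eval_up]; exact H.
  - split; intros H X; specialize (H X);
      [rewrite IH, scons_upS in H|rewrite IH, scons_upS]; exact H.
  - split; intros [X H]; exists X;
      [rewrite IH, scons_upS in H|rewrite IH, scons_upS]; exact H.
Qed.

Lemma sat_shift M r e x A : sat M (scons x r) e (shift A) <-> sat M r e A.
Proof. apply sat_subst. Qed.

Lemma sat_shiftS M r e X A : sat M r (scons X e) (shiftS A) <-> sat M r e A.
Proof. unfold shiftS. now rewrite sat_subst. Qed.

Lemma sat_inst M r e t A : sat M r e (inst t A) <-> sat M (scons (eval M r t) r) e A.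
Proof.
  unfold inst. rewrite sat_subst.
  replace (fun n => eval M r (scons t Var n)) with (scons (eval M r t) r); [reflexivity|].
  extensionality n. now destruct n.
Qed.

Definition BAll (t : term) (A : form) : form := All (Lt #0 (tshift t) --> A).
Definition BEx (t : term) (A : form) : form := Ex (Lt #0 (tshift t) //\\ A).

Ltac solve_delta0 :=
  unfold Iff, Neg, SRel, Rel;
  repeat (apply Delta0_All || apply Delta0_Ex || constructor).

Declare Scope num_scope.
Delimit Scope num_scope with num.
Notation "0" := (nzero _) : num_scope.
Notation "1" := (none _) : num_scope.
Notation "x + y" := (nadd x y) : num_scope.
Notation "x * y" := (nmul x y) : num_scope.
Notation "x < y" := (nlt x y) : num_scope.
Notation "x ∈ X" := (nmem x X) (at level 70) : num_scope.
Notation "⟨ x , y ⟩" := ((x + y) * (x + y) + x)%num (format "⟨ x ,  y ⟩") : num_scope.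
Notation "x .: r" := (scons x r) (at level 60, right associativity).

Section Models.

Variable M : structure.
Hypothesis M_RCA0 : models M RCA0.
(** An interpretation of formulas needs some value for every set variable. *)
Variable X0 : sets M.

Local Open Scope num_scope.

Let r0 : nat -> M := fun _ => 0.
Let e0 : nat -> sets M := fun _ => X0.

Lemma sigma1_ind A r e : Delta0 A ->
  (exists y, sat M (y .: 0 .: r) e A) ->
  (forall x, (exists y, sat M (y .: x .: r) e A) -> exists y, sat M (y .: x + 1 .: r) e A) ->
  forall x, exists y, sat M (y .: x .: r) e A.
Proof.
  intros HA H0 HS.
  assert (H := M_RCA0 _ r e (RCA0_induction _ (Sigma1_Ex _ HA))).
  cbn [sat] in H. apply H. split; [apply sat_inst, H0|].
  intros x Hx. unfold step. apply sat_subst.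
  replace (fun n => eval M (x .: r) (scons (Succ #0) (fun n => #(S n)) n)) with (x + 1 .: r).
  - apply HS, Hx.
  - extensionality n. now destruct n.
Qed.

Lemma delta1_comprehension A B r e : Delta0 A -> Delta0 B ->
  (forall n, (exists y, sat M (y .: n .: r) e A) <-> forall y, sat M (y .: n .: r) e B) ->
  exists X, forall n, n ∈ X <-> exists y, sat M (y .: n .: r) e A.
Proof.
  intros HA HB H.
  assert (HC := M_RCA0 _ r e (RCA0_comprehension _ _ (Sigma1_Ex _ HA) (Pi1_All _ HB))).
  cbn [sat Iff eval scons] in HC. destruct HC as [X HX].
  - intros n. split; apply H.
  - exists X. intros n. specialize (HX n). rewrite sat_shiftS in HX. exact HX.
Qed.

Lemma delta0_comprehension A r e : Delta0 A ->
  exists X, forall n, n ∈ X <-> sat M (n .: r) e A.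
Proof.
  intros HA.
  assert (HA' : Delta0 (shift A)) by now apply Delta0_subst.
  destruct (delta1_comprehension (shift A) (shift A) r e) as [X HX]; auto.
  - intros n. split.
    + intros [y Hy] z. apply sat_shift. now apply sat_shift in Hy.
    + intros H. exists 0. apply H.
  - exists X. intros n. rewrite HX. split.
    + intros [y Hy]. now apply sat_shift in Hy.
    + intros H. exists 0. now apply sat_shift.
Qed.

Lemma set_ind (X : sets M) : 0 ∈ X -> (forall n, n ∈ X -> n + 1 ∈ X) -> forall n, n ∈ X.
Proof.
  intros H0 HS n.
  destruct (sigma1_ind (Mem #1 0) r0 (fun _ => X)) with (x := n) as [y Hy]; auto.
  - constructor.
  - now exists 0.
  - intros x [y Hy]. exists 0. cbn in *. auto.
Qed.

Lemma delta0_ind A r e : Delta0 A ->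
  sat M (0 .: r) e A -> (forall n, sat M (n .: r) e A -> sat M (n + 1 .: r) e A) ->
  forall n, sat M (n .: r) e A.
Proof.
  intros HA H0 HS n. destruct (delta0_comprehension A r e HA) as [X HX].
  apply HX, set_ind; [now apply HX|]. intros m Hm. now apply HX, HS, HX.
Qed.

Lemma succ_nonzero x : x + 1 <> (0 : M).
Proof. exact (M_RCA0 _ r0 e0 RCA0_succ_nonzero x). Qed.

Lemma succ_inj (x y : M) : x + 1 = y + 1 -> x = y.
Proof. exact (M_RCA0 _ r0 e0 RCA0_succ_inj x y). Qed.

Lemma add_0_r (x : M) : x + 0 = x.
Proof. exact (M_RCA0 _ r0 e0 RCA0_add_zero x). Qed.

Lemma add_S_r (x y : M) : x + (y + 1) = x + y + 1.
Proof. exact (M_RCA0 _ r0 e0 RCA0_add_succ x y). Qed.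

Lemma mul_0_r (x : M) : x * 0 = 0.
Proof. exact (M_RCA0 _ r0 e0 RCA0_mul_zero x). Qed.

Lemma mul_S_r (x y : M) : x * (y + 1) = x * y + x.
Proof. exact (M_RCA0 _ r0 e0 RCA0_mul_succ x y). Qed.

Lemma lt_0_r (x : M) : ~ x < 0.
Proof. exact (M_RCA0 _ r0 e0 RCA0_lt_zero x). Qed.

Lemma lt_S_r (x y : M) : x < y + 1 <-> x < y \/ x = y.
Proof. exact (M_RCA0 _ r0 e0 RCA0_lt_succ x y). Qed.

Lemma add_assoc (x y z : M) : x + (y + z) = x + y + z.
Proof.
  apply (delta0_ind (Eq (Add #1 (Add #2 #0)) (Add (Add #1 #2) #0)) (x .: y .: r0) e0);
    [solve_delta0|..]; cbn.
  - now rewrite !add_0_r.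
  - intros n H. now rewrite !add_S_r, H.
Qed.

Lemma add_0_l (x : M) : 0 + x = x.
Proof.
  apply (delta0_ind (Eq (Add Zero #0) #0) r0 e0); [solve_delta0|..]; cbn.
  - apply add_0_r.
  - intros n H. now rewrite add_S_r, H.
Qed.

Lemma add_S_l (x y : M) : x + 1 + y = x + y + 1.
Proof.
  apply (delta0_ind (Eq (Add (Succ #1) #0) (Succ (Add #1 #0))) (x .: r0) e0);
    [solve_delta0|..]; cbn.
  - now rewrite !add_0_r.
  - intros n H. now rewrite !add_S_r, H.
Qed.

Lemma add_comm (x y : M) : x + y = y + x.
Proof.
  apply (delta0_ind (Eq (Add #1 #0) (Add #0 #1)) (x .: r0) e0); [solve_delta0|..]; cbn.
  - now rewrite add_0_l, add_0_r.
  - intros n H. now rewrite add_S_l, add_S_r, H.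
Qed.

Lemma mul_0_l (x : M) : 0 * x = 0.
Proof.
  apply (delta0_ind (Eq (Mul Zero #0) Zero) r0 e0); [solve_delta0|..]; cbn.
  - apply mul_0_r.
  - intros n H. now rewrite mul_S_r, H, add_0_r.
Qed.

Lemma mul_add_l (x y z : M) : (x + y) * z = x * z + y * z.
Proof.
  apply (delta0_ind (Eq (Mul (Add #1 #2) #0) (Add (Mul #1 #0) (Mul #2 #0))) (x .: y .: r0) e0);
    [solve_delta0|..]; cbn.
  - now rewrite !mul_0_r, add_0_r.
  - intros n H. rewrite !mul_S_r, H, <- !add_assoc. f_equal.
    now rewrite !add_assoc, (add_comm x).
Qed.

Lemma mul_1_l (x : M) : 1 * x = x.
Proof.
  apply (delta0_ind (Eq (Mul One #0) #0) r0 e0); [solve_delta0|..]; cbn.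
  - apply mul_0_r.
  - intros n H. now rewrite mul_S_r, H.
Qed.

Lemma mul_comm (x y : M) : x * y = y * x.
Proof.
  apply (delta0_ind (Eq (Mul #1 #0) (Mul #0 #1)) (x .: r0) e0); [solve_delta0|..]; cbn.
  - now rewrite mul_0_l, mul_0_r.
  - intros n H. now rewrite mul_S_r, mul_add_l, mul_1_l, H.
Qed.

Lemma mul_assoc (x y z : M) : x * (y * z) = x * y * z.
Proof.
  apply (delta0_ind (Eq (Mul #1 (Mul #2 #0)) (Mul (Mul #1 #2) #0)) (x .: y .: r0) e0);
    [solve_delta0|..]; cbn.
  - now rewrite !mul_0_r.
  - intros n H. rewrite !mul_S_r, <- H.
    now rewrite !(mul_comm x), mul_add_l.
Qed.

Lemma num_semi_ring : semi_ring_theory (nzero M) (none M) nadd nmul eq.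
Proof.
  constructor; intros; auto using add_0_l, add_comm, add_assoc, mul_1_l, mul_0_l,
    mul_comm, mul_assoc, mul_add_l.
Qed.

Add Ring num_ring : num_semi_ring.

Lemma add_cancel_r (x y z : M) : x + z = y + z -> x = y.
Proof.
  apply (delta0_ind (Eq (Add #1 #0) (Add #2 #0) --> Eq #1 #2) (x .: y .: r0) e0);
    [solve_delta0|..]; cbn.
  - now rewrite !add_0_r.
  - intros n H. rewrite !add_S_r. intros E. now apply H, succ_inj.
Qed.

Lemma add_cancel_l (x y z : M) : z + x = z + y -> x = y.
Proof. rewrite !(add_comm z). apply add_cancel_r. Qed.

Lemma zero_or_succ (x : M) : x = 0 \/ exists y, x = y + 1.
Proof.
  destruct (sigma1_ind (Eq #1 Zero \\// Eq #1 (Succ #0)) r0 e0) with (x := x) as [y [Hy|Hy]].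
  - solve_delta0.
  - exists 0. now left.
  - intros n _. exists n. now right.
  - now left.
  - right. now exists y.
Qed.

Lemma lt_add (x d : M) : x < x + d + 1.
Proof.
  apply (delta0_ind (Lt #1 (Succ (Add #1 #0))) (x .: r0) e0); [solve_delta0|..]; cbn.
  - apply lt_S_r. right. now rewrite add_0_r.
  - intros n H. rewrite add_S_r. apply lt_S_r. now left.
Qed.

Lemma lt_iff (x y : M) : x < y <-> exists d, y = x + d + 1.
Proof.
  split; [|intros [d ->]; apply lt_add].
  intros H.
  destruct (sigma1_ind (Lt #2 #1 --> Eq #1 (Succ (Add #2 #0))) (x .: r0) e0) with (x := y)
    as [d Hd]; [solve_delta0|..]; cbn in *.
  - exists 0. intros H0. now apply lt_0_r in H0.
  - intros n [d Hd]. destruct (classic (x < n)) as [Hn|Hn].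
    + exists (d + 1). intros _. rewrite Hd at 1 by assumption. ring.
    + exists 0. intros Hx. apply lt_S_r in Hx. destruct Hx as [Hx| ->]; [easy|ring].
  - exists d. auto.
Qed.

Lemma add_succ_neq (x d : M) : x <> x + d + 1.
Proof.
  intros H. apply (succ_nonzero d). apply add_cancel_l with x.
  rewrite add_assoc, add_0_r. now symmetry.
Qed.

Lemma lt_irrefl (x : M) : ~ x < x.
Proof. rewrite lt_iff. intros [d H]. now apply add_succ_neq in H. Qed.

Lemma lt_trans (x y z : M) : x < y -> y < z -> x < z.
Proof.
  rewrite !lt_iff. intros [d ->] [d' ->]. exists (d + d' + 1). ring.
Qed.

Lemma lt_asym (x y : M) : x < y -> ~ y < x.
Proof. intros H H'. apply (lt_irrefl x). now apply lt_trans with y. Qed.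

Lemma lt_total (x y : M) : x < y \/ x = y \/ y < x.
Proof.
  apply (delta0_ind (Lt #0 #1 \\// Eq #0 #1 \\// Lt #1 #0) (y .: r0) e0);
    [solve_delta0|..]; cbn.
  - destruct (zero_or_succ y) as [->|[z ->]]; [tauto|].
    left. apply lt_iff. exists z. ring.
  - intros n [H|[-> |H]].
    + apply lt_iff in H. destruct H as [d ->].
      destruct (zero_or_succ d) as [->|[c ->]].
      * right; left. ring.
      * left. apply lt_iff. exists c. ring.
    + right; right. apply lt_S_r. now right.
    + right; right. apply lt_S_r. now left.
Qed.

Lemma not_lt (x y : M) : ~ x < y <-> exists d, x = y + d.
Proof.
  split.
  - intros H. destruct (lt_total x y) as [Hx|[-> |Hx]]; [easy| |].
    + exists 0. ring.
    + apply lt_iff in Hx. destruct Hx as [d ->]. exists (d + 1). ring.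
  - intros [d ->] H. apply lt_iff in H. destruct H as [c H].
    apply (add_succ_neq y (d + c)). rewrite H at 1. ring.
Qed.

Lemma lt_S_iff (x y : M) : x < y + 1 <-> exists d, y = x + d.
Proof.
  rewrite lt_S_r, lt_iff. split.
  - intros [[d ->]| ->]; [exists (d + 1)|exists 0]; ring.
  - intros [d ->]. destruct (zero_or_succ d) as [->|[c ->]].
    + right. ring.
    + left. exists c. ring.
Qed.

Lemma lt_S (x : M) : x < x + 1.
Proof. apply lt_S_iff. exists 0. ring. Qed.

Lemma lt_lt_S (x y z : M) : x < y -> y < z + 1 -> x < z.
Proof. rewrite lt_S_r. intros H [H'| ->]; [now apply lt_trans with y|assumption]. Qed.

Lemma le_lt_trans (x y z : M) : ~ y < x -> y < z -> x < z.
Proof. intros H H'. destruct (lt_total x y) as [E|[-> |E]]; [now apply lt_trans with y|easy..]. Qed.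

Lemma lt_bounds (x y : M) : exists k, x < k /\ y < k.
Proof.
  exists (x + y + 1). rewrite !lt_S_iff. split; [exists y|exists x]; ring.
Qed.

Lemma pair_lt (s t s' t' : M) : s + t < s' + t' -> ⟨s, t⟩ < ⟨s', t'⟩.
Proof.
  intros H. apply lt_iff in H. destruct H as [d H]. apply lt_iff. rewrite H.
  exists (t + (s + t) + (s + t) * d + (s + t) * d + d * d + d + d + s'). ring.
Qed.

Lemma pair_lt_r (x s t : M) : s < t -> ⟨x, s⟩ < ⟨x, t⟩.
Proof.
  intros H. apply pair_lt. apply lt_iff in H. destruct H as [d ->].
  apply lt_iff. exists d. ring.
Qed.

Lemma pair_inj (s t s' t' : M) : ⟨s, t⟩ = ⟨s', t'⟩ -> s = s' /\ t = t'.
Proof.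
  intros H. destruct (lt_total (s + t) (s' + t')) as [Hlt|[E|Hlt]].
  1, 3: apply pair_lt in Hlt; rewrite H in Hlt; now apply lt_irrefl in Hlt.
  rewrite E in H. apply add_cancel_l in H. subst s'. split; [reflexivity|].
  now apply add_cancel_l in E.
Qed.

Lemma pair_le_l (s t : M) : s < ⟨s, t⟩ + 1.
Proof. apply lt_S_iff. exists ((s + t) * (s + t)). ring. Qed.

Lemma pair_le_r (s t : M) : t < ⟨s, t⟩ + 1.
Proof.
  apply lt_S_iff. destruct (zero_or_succ t) as [->|[u ->]].
  - exists ⟨s, 0⟩. ring.
  - exists (s + u * (s + (u + 1)) + s + s * (s + (u + 1))). ring.
Qed.

Lemma le_trans_S (x y z : M) : x < y + 1 -> y < z + 1 -> x < z + 1.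
Proof. rewrite !lt_S_iff. intros [d ->] [c ->]. exists (d + c). ring. Qed.

Lemma double_inj (x y : M) : x + x = y + y -> x = y.
Proof.
  intros H. destruct (lt_total x y) as [L|[E|L]]; [|exact E|];
    apply lt_iff in L; destruct L as [d ->]; exfalso.
  - apply (add_succ_neq (x + x) (d + d + 1)). rewrite H at 1. ring.
  - apply (add_succ_neq (y + y) (d + d + 1)). rewrite <- H at 1. ring.
Qed.

Lemma double_odd (x y : M) : x + x <> y + y + 1.
Proof.
  intros H. destruct (lt_total x y) as [L|[-> |L]].
  - apply lt_iff in L. destruct L as [d ->].
    apply (add_succ_neq (x + x) (d + d + 1 + 1)). rewrite H at 1. ring.
  - apply (add_succ_neq (y + y) 0). rewrite H at 1. ring.
  - apply lt_iff in L. destruct L as [d ->].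
    apply (add_succ_neq (y + y + 1) (d + d)). rewrite <- H at 1. ring.
Qed.

Lemma delta0_comprehension_pairs A r e : Delta0 A ->
  exists X, (forall z, z ∈ X -> exists a b, z = ⟨a, b⟩) /\
    forall a b, ⟨a, b⟩ ∈ X <-> sat M (b .: a .: ⟨a, b⟩ .: r) e A.
Proof.
  intros HA.
  destruct (delta0_comprehension
    (BEx (Succ #0) (BEx (Succ #1) (Eq #2 (npair #1 #0) //\\ A))) r e) as [X HX].
  - unfold BEx. repeat (apply Delta0_Ex || constructor); assumption.
  - exists X. split.
    + intros z Hz. apply HX in Hz. cbn in Hz.
      destruct Hz as (a & _ & b & _ & E & _). now exists a, b.
    + intros a b. rewrite HX. cbn. split.
      * intros (a' & _ & b' & _ & E & H).
        apply pair_inj in E. destruct E as [<- <-]. exact H.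
      * intros H. exists a. split; [apply pair_le_l|]. exists b.
        split; [apply pair_le_r|]. auto.
Qed.

Lemma delta0_comprehension2 A r e : Delta0 A ->
  exists X, forall a b, ⟨a, b⟩ ∈ X <-> sat M (b .: a .: ⟨a, b⟩ .: r) e A.
Proof.
  intros HA. destruct (delta0_comprehension_pairs A r e HA) as (X & _ & HX). now exists X.
Qed.

Lemma delta0_comprehension3 A r e : Delta0 A ->
  exists X, forall a b c, ⟨⟨a, b⟩, c⟩ ∈ X <->
    sat M (b .: a .: c .: ⟨a, b⟩ .: ⟨⟨a, b⟩, c⟩ .: r) e A.
Proof.
  intros HA.
  destruct (delta0_comprehension2
    (BEx (Succ #1) (BEx (Succ #2) (Eq #3 (npair #1 #0) //\\ A))) r e) as [X HX].
  - unfold BEx. repeat (apply Delta0_Ex || constructor); assumption.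
  - exists X. intros a b c. rewrite HX. cbn. split.
    + intros (a' & _ & b' & _ & E & H).
      apply pair_inj in E. destruct E as [<- <-]. exact H.
    + intros H. exists a. split; [apply pair_le_l|]. exists b. split; [apply pair_le_r|].
      auto.
Qed.

(** * Finite sets and recursion *)

Definition divides (x y : M) : Prop := exists d, d * x = y.

Lemma divides_mul_l (x y z : M) : divides x y -> divides x (z * y).
Proof. intros [d <-]. exists (z * d). ring. Qed.

Lemma divides_bounded (x y : M) :
  (exists d, d < y + 1 /\ d * (x + 1) = y) <-> divides (x + 1) y.
Proof.
  split; intros [d H]; exists d; [apply H|]. split; [|exact H].
  apply lt_S_iff. exists (d * x). rewrite <- H. ring.
Qed.

Lemma divides_add_cancel (m x y : M) : divides m (x + y) -> divides m x -> divides m y.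
Proof.
  intros [v Hv] [u Hu]. subst x. destruct (lt_total v u) as [H|H].
  - apply lt_iff in H. destruct H as [w ->].
    assert (E : 0 = (w + 1) * m + y).
    { apply add_cancel_l with (v * m). rewrite add_0_r. etransitivity; [exact Hv|ring]. }
    exists 0. destruct (zero_or_succ y) as [->|[z ->]]; [ring|].
    destruct (succ_nonzero ((w + 1) * m + z)). rewrite E. ring.
  - assert (exists w, v = u + w) as [w ->].
    { apply lt_S_iff, lt_S_r. destruct H as [->|H]; auto. }
    exists w. apply add_cancel_l with (u * m). rewrite <- Hv. ring.
Qed.

(** [b], and hence each divisor [c] of [b], is a unit modulo [(i + 1) b + 1]. *)
Lemma modulus_cancel (b i c a : M) :
  divides c b -> divides ((i + 1) * b + 1) (a * (c * b)) -> divides ((i + 1) * b + 1) a.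
Proof.
  intros [q Hq] H.
  assert (Hb : forall y, divides ((i + 1) * b + 1) (y * b) -> divides ((i + 1) * b + 1) y).
  { intros y Hy. apply divides_add_cancel with ((i + 1) * (y * b)).
    - exists y. ring.
    - now apply divides_mul_l. }
  apply Hb, Hb. replace (a * b * b) with (q * (a * (c * b))).
  - now apply divides_mul_l.
  - rewrite <- Hq. ring.
Qed.

Lemma modulus_coprime (b i k d a : M) :
  i = k + d + 1 \/ k = i + d + 1 -> divides (d + 1) b ->
  divides ((i + 1) * b + 1) (a * ((k + 1) * b + 1)) -> divides ((i + 1) * b + 1) a.
Proof.
  intros Hik Hd H. apply modulus_cancel with (d + 1); [exact Hd|].
  destruct Hik as [-> | ->].
  - apply divides_add_cancel with (a * ((k + 1) * b + 1)); [|exact H]. exists a. ring.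
  - apply divides_add_cancel with (a * ((i + 1) * b + 1)); [|exists a; ring].
    destruct H as [q H]. exists q. rewrite H. ring.
Qed.

Lemma common_multiple (n : M) :
  exists b, b <> 0 /\ forall d, d < n -> divides (d + 1) b.
Proof.
  destruct (sigma1_ind
    (Neg (Eq #0 Zero) //\\ BAll #1 (BEx (Succ #1) (Eq (Mul #0 (Succ #1)) #2))) r0 e0)
    with (x := n) as [b [Hb H]]; [solve_delta0|..]; cbn in *.
  - exists 1. split.
    + intros H. apply (succ_nonzero 0). now rewrite add_0_l.
    + intros d Hd. now apply lt_0_r in Hd.
  - intros k [b [Hb H]]. exists (b * (k + 1)). split.
    + destruct (zero_or_succ b) as [->|[c ->]]; [easy|].
      intros E. apply (succ_nonzero (c * k + c + k)). rewrite <- E. ring.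
    + intros d Hd. apply divides_bounded. apply lt_S_r in Hd. destruct Hd as [Hd| ->].
      * rewrite mul_comm. apply divides_mul_l, divides_bounded, H, Hd.
      * now exists b.
  - exists b. split; [exact Hb|]. intros d Hd. now apply divides_bounded, H.
Qed.

Lemma product_code (X : sets M) (n b : M) :
  b <> 0 -> (forall d, d < n -> divides (d + 1) b) ->
  exists a, forall i, i < n -> (divides ((i + 1) * b + 1) a <-> i ∈ X).
Proof.
  intros Hb Hn.
  set (Q (k a : M) := forall i, i < n ->
    ((exists q, q < a + 1 /\ q * ((i + 1) * b + 1) = a) <-> i < k /\ i ∈ X)).
  assert (H : forall k, exists a, Q k a).
  { apply (sigma1_ind (BAll #2 (BEx (Succ #1) (Eq (Mul #0 (Succ (Mul (Succ #1) #5))) #2)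
                               <--> (Lt #0 #2 //\\ Mem #0 0))) (n .: b .: r0) (fun _ => X));
      [solve_delta0|..].
    - change (exists a, Q 0 a). exists 1. intros i _. rewrite divides_bounded. split.
      + intros [q H]. exfalso. destruct (zero_or_succ b) as [->|[c ->]]; [easy|].
        destruct (zero_or_succ q) as [->|[p ->]].
        * apply (succ_nonzero 0). rewrite add_0_l. etransitivity; [symmetry; exact H|ring].
        * apply (succ_nonzero (p * i * c + p * i + p * c + p + p + i * c + i + c)).
          apply succ_inj. rewrite add_0_l. etransitivity; [|exact H]. ring.
      + intros [H _]. now apply lt_0_r in H.
    - intros k. change ((exists a, Q k a) -> exists a, Q (k + 1) a). intros [a Ha].
      destruct (classic (k < n /\ k ∈ X)) as [[Hk HkX]|Hk].
      + exists (a * ((k + 1) * b + 1)). intros i Hi. rewrite divides_bounded.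
        specialize (Ha i Hi). cbn in Ha. rewrite divides_bounded in Ha.
        destruct (classic (i = k)) as [->|Hik].
        * split; [|intros _; now exists a]. intros _. split; [apply lt_S|exact HkX].
        * assert (E : i < k + 1 <-> i < k) by (rewrite lt_S_r; tauto).
          rewrite E, <- Ha. split.
          -- destruct (lt_total i k) as [L|[L|L]]; [|easy|]; apply lt_iff in L;
               destruct L as [d Hd]; apply modulus_coprime with d; auto; apply Hn.
             ++ apply lt_trans with k; [|exact Hk]. apply lt_iff. exists i.
                rewrite Hd. ring.
             ++ apply lt_trans with i; [|exact Hi]. apply lt_iff. exists k.
                rewrite Hd. ring.
          -- intros H. rewrite (mul_comm a). now apply divides_mul_l.
      + exists a. intros i Hi. rewrite (Ha i Hi), lt_S_r.
        split; [tauto|]. intros [[L| ->] HX]; tauto. }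
  destruct (H n) as [a Ha]. exists a. intros i Hi.
  rewrite <- divides_bounded, (Ha i Hi). tauto.
Qed.

Lemma finite_set_codes :
  exists E, forall (X : sets M) n, exists c, forall i, i < n -> (⟨i, c⟩ ∈ E <-> i ∈ X).
Proof.
  destruct (delta0_comprehension2
    (BEx (Succ #0) (BEx (Succ #1) (Eq #2 (npair #1 #0) //\\
       BEx (Succ #1) (Eq (Mul #0 (Succ (Mul (Succ #4) #1))) #2)))) r0 e0) as [E HE];
    [solve_delta0|].
  exists E. intros X n. destruct (common_multiple n) as [b [Hb Hn]].
  destruct (product_code X n b Hb Hn) as [a Ha].
  exists ⟨a, b⟩. intros i Hi. rewrite <- (Ha i Hi), HE. cbn. split.
  - intros (a' & _ & b' & _ & Eab & H). apply pair_inj in Eab. destruct Eab as [<- <-].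
    now apply divides_bounded.
  - intros H. exists a. split; [apply pair_le_l|]. exists b. split; [apply pair_le_r|].
    split; [reflexivity|]. now apply divides_bounded.
Qed.

Lemma set_strong_ind (X : sets M) :
  (forall n, (forall m, m < n -> m ∈ X) -> n ∈ X) -> forall n, n ∈ X.
Proof.
  intros H n.
  assert (Hn : forall k m, m < k -> m ∈ X).
  { apply (delta0_ind (BAll #0 (Mem #0 0)) r0 (fun _ => X)); [solve_delta0|..]; cbn.
    - intros m Hm. now apply lt_0_r in Hm.
    - intros k Hk m Hm. apply lt_S_r in Hm. destruct Hm as [Hm| ->]; auto. }
  apply (Hn (n + 1)), lt_S.
Qed.

Section Recursion.

Variables E B G : sets M.
Hypothesis codes : forall (X : sets M) n, exists c, forall i, i < n -> (⟨i, c⟩ ∈ E <-> i ∈ X).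

Definition reach_upto (k c : M) : Prop := forall y, y < k ->
  (⟨y, c⟩ ∈ E <-> y ∈ B \/ exists z, z < y /\ ⟨y, z⟩ ∈ G /\ ⟨z, c⟩ ∈ E).

Definition reach_form (k c : term) : form :=
  BAll k (Rel 0 #0 (tshift c) <-->
    (Mem #0 1 \\// BEx #0 (Rel 2 #1 #0 //\\ Rel 0 #0 (tshift (tshift c))))).

Let eG : nat -> sets M := E .: B .: G .: e0.

Lemma reach_upto_unique (k k' c c' : M) : reach_upto k c -> reach_upto k' c' ->
  forall y, y < k -> y < k' -> (⟨y, c⟩ ∈ E <-> ⟨y, c'⟩ ∈ E).
Proof.
  intros H H'.
  destruct (delta0_comprehension
    (Lt #0 #1 --> Lt #0 #2 --> (Rel 0 #0 #3 <--> Rel 0 #0 #4))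
    (k .: k' .: c .: c' .: r0) eG) as [X HX]; [solve_delta0|]. cbn in HX.
  intros y. apply (HX y), set_strong_ind. clear y. intros y Hy. apply HX. intros Hk Hk'.
  fold (iff (⟨y, c⟩ ∈ E) (⟨y, c'⟩ ∈ E)).
  rewrite (H y Hk), (H' y Hk').
  assert (Hz : forall z, z < y -> (⟨z, c⟩ ∈ E <-> ⟨z, c'⟩ ∈ E)).
  { intros z Hz. apply HX; [now apply Hy|now apply lt_trans with y..]. }
  split; (intros [Hb|[z (L & HG & HE)]]; [now left|right; exists z]);
    (split; [exact L|]; split; [exact HG|]; now apply (Hz z L)).
Qed.

Lemma reach_upto_ex (k : M) : exists c, reach_upto k c.
Proof.
  revert k. apply (sigma1_ind (reach_form #1 #0) r0 eG); [solve_delta0|..].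
  - exists 0. intros y Hy. now apply lt_0_r in Hy.
  - intros k [c Hc]. change (reach_upto k c) in Hc.
    change (exists c, reach_upto (k + 1) c).
    destruct (delta0_comprehension
      ((Lt #0 #1 //\\ Rel 0 #0 #2) \\//
       (Eq #0 #1 //\\ (Mem #0 1 \\// BEx #0 (Rel 2 #1 #0 //\\ Rel 0 #0 #3))))
      (k .: c .: r0) eG) as [X HX]; [solve_delta0|]. cbn in HX.
    destruct (codes X (k + 1)) as [c' Hc']. exists c'.
    assert (Hlow : forall y, y < k -> (⟨y, c'⟩ ∈ E <-> ⟨y, c⟩ ∈ E)).
    { intros y Hy. rewrite Hc', HX; [|apply lt_S_r; auto].
      split; [|auto]. intros [[_ H]|[-> _]]; [exact H|now apply lt_irrefl in Hy]. }
    assert (Htop : ⟨k, c'⟩ ∈ E <-> k ∈ B \/ exists z, z < k /\ ⟨k, z⟩ ∈ G /\ ⟨z, c⟩ ∈ E).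
    { rewrite Hc', HX; [|apply lt_S]. split; [|auto].
      intros [[H _]|[_ H]]; [now apply lt_irrefl in H|exact H]. }
    assert (Hex : forall y, y < k + 1 ->
        (exists z, z < y /\ ⟨y, z⟩ ∈ G /\ ⟨z, c⟩ ∈ E) <->
        (exists z, z < y /\ ⟨y, z⟩ ∈ G /\ ⟨z, c'⟩ ∈ E)).
    { intros y Hy. split; intros [z (L & HG & HE)]; exists z;
        (split; [exact L|]; split; [exact HG|]; apply Hlow; [now apply lt_lt_S with y|exact HE]). }
    intros y Hy. rewrite <- (Hex y Hy). apply lt_S_r in Hy. destruct Hy as [Hy| ->].
    + rewrite (Hlow y Hy). apply Hc, Hy.
    + exact Htop.
Qed.

Lemma recursion_from_codes :
  exists T, forall y, y ∈ T <-> y ∈ B \/ exists z, z < y /\ ⟨y, z⟩ ∈ G /\ z ∈ T.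
Proof.
  destruct (delta1_comprehension
    (reach_form (Succ #1) #0 //\\ Rel 0 #1 #0) (reach_form (Succ #1) #0 --> Rel 0 #1 #0)
    r0 eG) as [T HT]; [solve_delta0..| |].
  - intros y. split.
    + intros [c [Hc Hy]] c' Hc'. cbn in Hy |- *.
      apply (reach_upto_unique (y + 1) (y + 1) c c' Hc Hc'); [apply lt_S..|exact Hy].
    + intros H. destruct (reach_upto_ex (y + 1)) as [c Hc]. exists c.
      split; [exact Hc|]. now apply H.
  - assert (HT' : forall k c, reach_upto k c -> forall y, y < k -> (y ∈ T <-> ⟨y, c⟩ ∈ E)).
    { intros k c Hc y Hy. rewrite HT. split.
      - intros [c' [Hc' H]].
        apply (reach_upto_unique (y + 1) k c' c Hc' Hc y (lt_S y) Hy), H.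
      - intros H. destruct (reach_upto_ex (y + 1)) as [c' Hc']. exists c'.
        split; [exact Hc'|]. cbn.
        now apply (reach_upto_unique (y + 1) k c' c Hc' Hc y (lt_S y) Hy). }
    exists T. intros y. destruct (reach_upto_ex (y + 1)) as [c Hc].
    rewrite (HT' _ _ Hc y (lt_S y)), (Hc y (lt_S y)).
    split; (intros [Hb|[z (L & HG & HE)]]; [now left|right; exists z]);
      (split; [exact L|]; split; [exact HG|]); apply (HT' _ _ Hc z); auto;
      apply lt_S_r; auto.
Qed.

End Recursion.

Lemma recursion (B G : sets M) :
  exists T, forall y, y ∈ T <-> y ∈ B \/ exists z, z < y /\ ⟨y, z⟩ ∈ G /\ z ∈ T.
Proof.
  destruct finite_set_codes as [E HE]. exact (recursion_from_codes E B G HE).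
Qed.

Ltac split_pairs :=
  repeat match goal with
  | H : ⟨_, _⟩ = ⟨_, _⟩ |- _ => apply pair_inj in H; destruct H
  | H : _ + _ = _ + _ + 1 |- _ => now apply double_odd in H
  | H : _ + _ + 1 = _ + _ |- _ => symmetry in H; now apply double_odd in H
  | H : _ + _ + 1 = _ + _ + 1 |- _ => apply succ_inj in H
  | H : _ + _ = _ + _ |- _ => apply double_inj in H
  end; subst.

Lemma le_pair_double (x z u : M) : u = z + z \/ u = z + z + 1 -> z < ⟨x, u⟩ + 1.
Proof.
  intros Hu. apply le_trans_S with u; [|apply pair_le_r].
  apply lt_S_iff. destruct Hu as [->| ->]; [exists z|exists (z + 1)]; ring.
Qed.

(** The two sets are coded into one, [U] at the even and [V] at the odd second components,
    so that each recursive call decreases the argument. *)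
Lemma simultaneous_recursion (BU BV D H1 H2 H3 : sets M) :
  exists U V, forall x z,
  (⟨x, z⟩ ∈ U <-> ⟨x, z⟩ ∈ BU \/ ~ ⟨x, z⟩ ∈ D /\ exists p, p < z /\
     (⟨z, p⟩ ∈ H1 /\ ⟨x, p⟩ ∈ V \/ ⟨z, p⟩ ∈ H2 /\ ⟨x, p⟩ ∈ U)) /\
  (⟨x, z⟩ ∈ V <-> ⟨x, z⟩ ∈ BV \/ ~ ⟨x, z⟩ ∈ D /\ exists p, p < z /\
     (⟨z, p⟩ ∈ H3 /\ ⟨x, p⟩ ∈ U \/ ⟨z, p⟩ ∈ H2 /\ ⟨x, p⟩ ∈ V)).
Proof.
  set (e := BU .: BV .: D .: H1 .: H2 .: H3 .: e0).
  destruct (delta0_comprehension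
    (BEx (Succ #0) (BEx (Succ #1)
      ((Eq #2 (npair #1 (Add #0 #0)) //\\ Rel 0 #1 #0) \\//
       (Eq #2 (npair #1 (Succ (Add #0 #0))) //\\ Rel 1 #1 #0)))) r0 e)
    as [B HB]; [solve_delta0|]. cbn in HB.
  destruct (delta0_comprehension2
    (BEx (Succ #1) (BEx (Succ #2) (BEx #0 (Neg (Rel 2 #2 #1) //\\
      ((Eq #4 (npair #2 (Add #1 #1)) //\\ Eq #3 (npair #2 (Succ (Add #0 #0))) //\\ Rel 3 #1 #0) \\//
       (Eq #4 (npair #2 (Add #1 #1)) //\\ Eq #3 (npair #2 (Add #0 #0)) //\\ Rel 4 #1 #0) \\//
       (Eq #4 (npair #2 (Succ (Add #1 #1))) //\\ Eq #3 (npair #2 (Add #0 #0)) //\\ Rel 5 #1 #0) \\//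
       (Eq #4 (npair #2 (Succ (Add #1 #1))) //\\ Eq #3 (npair #2 (Succ (Add #0 #0))) //\\ Rel 4 #1 #0)
      ))))) r0 e) as [G HG]; [solve_delta0|]. cbn in HG.
  destruct (recursion B G) as [T HT].
  destruct (delta0_comprehension2 (Mem (npair #1 (Add #0 #0)) 0) r0 (T .: e0))
    as [U HU]; [solve_delta0|]. cbn in HU.
  destruct (delta0_comprehension2 (Mem (npair #1 (Succ (Add #0 #0))) 0) r0 (T .: e0))
    as [V HV]; [solve_delta0|]. cbn in HV.
  assert (Hlt : forall x z p : M, p < z ->
    ⟨x, p + p⟩ < ⟨x, z + z⟩ /\ ⟨x, p + p + 1⟩ < ⟨x, z + z⟩ /\
    ⟨x, p + p⟩ < ⟨x, z + z + 1⟩ /\ ⟨x, p + p + 1⟩ < ⟨x, z + z + 1⟩).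
  { intros x z p H. apply lt_iff in H. destruct H as [d ->].
    repeat split; apply pair_lt_r, lt_iff;
      [exists (d + d + 1)|exists (d + d)|exists (d + d + 1 + 1)|exists (d + d + 1)]; ring. }
  exists U, V. intros x z. split.
  - rewrite HU, HT, HB. split.
    + intros [(x' & _ & z' & _ & [[E H]|[E H]])|(y & _ & H & Hy)]; [split_pairs; auto..|].
      apply HG in H.
      destruct H as (x' & _ & z' & _ & p & L & HD & [(E & E' & H)|[(E & E' & H)|[(E & E' & H)|(E & E' & H)]]]);
        split_pairs; right; (split; [exact HD|]; exists p; split; [exact L|]);
        rewrite HU, HV; auto.
    + intros [H|(HD & p & L & H)].
      * left. exists x. split; [apply pair_le_l|]. exists z.
        split; [apply le_pair_double; auto|auto].
      * right. rewrite HU, HV in H. destruct (Hlt x z p L) as (L1 & L2 & _).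
        destruct H as [[H HT']|[H HT']]; eexists; (split; [|split; [apply HG|exact HT']]); auto;
          exists x; (split; [apply pair_le_l|]; exists z; split; [apply le_pair_double; auto|]);
          exists p; auto 8.
  - rewrite HV, HT, HB. split.
    + intros [(x' & _ & z' & _ & [[E H]|[E H]])|(y & _ & H & Hy)]; [split_pairs; auto..|].
      apply HG in H.
      destruct H as (x' & _ & z' & _ & p & L & HD & [(E & E' & H)|[(E & E' & H)|[(E & E' & H)|(E & E' & H)]]]);
        split_pairs; right; (split; [exact HD|]; exists p; split; [exact L|]);
        rewrite HU, HV; auto.
    + intros [H|(HD & p & L & H)].
      * left. exists x. split; [apply pair_le_l|]. exists z.
        split; [apply le_pair_double; auto|auto].
      * right. rewrite HU, HV in H. destruct (Hlt x z p L) as (_ & _ & L1 & L2).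
        destruct H as [[H HT']|[H HT']]; eexists; (split; [|split; [apply HG|exact HT']]); auto;
          exists x; (split; [apply pair_le_l|]; exists z; split; [apply le_pair_double; auto|]);
          exists p; auto 8.
Qed.

(** * Cuts *)

Section Semiorder.

Variable P : M -> Prop.
Variable prec : M -> M -> Prop.
Hypothesis prec_irrefl : forall p, ~ prec p p.
Hypothesis no_2plus2 : forall p0 q0 p1 q1, P p0 -> P q0 -> P p1 -> P q1 ->
  prec p0 q0 -> prec p1 q1 -> prec p0 q1 \/ prec p1 q0.
Hypothesis no_3plus1 : forall p0 p1 p2 q, P p0 -> P p1 -> P p2 -> P q ->
  prec p0 p1 -> prec p1 p2 -> prec p0 q \/ prec q p2.

(** Some element below [k] shows that in every proper representation the interval
    of [p] begins and ends before the interval of [q] does. *)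
Definition before (k p q : M) : Prop :=
  exists r, r < k /\ P r /\ (prec r q /\ ~ prec r p \/ prec p r /\ ~ prec q r).

Lemma before_lower k p q r : r < k -> P r -> prec r q -> ~ prec r p -> before k p q.
Proof. intros. exists r. auto. Qed.

Lemma before_upper k p q r : r < k -> P r -> prec p r -> ~ prec q r -> before k p q.
Proof. intros. exists r. auto. Qed.

Lemma before_mono k p q : before k p q -> before (k + 1) p q.
Proof. intros (r & L & H). exists r. split; [apply lt_S_r; auto|exact H]. Qed.

Lemma before_asym k k' p q : P p -> P q -> before k p q -> ~ before k' q p.
Proof.
  intros Hp Hq (r & _ & Hr & [[H1 H2]|[H1 H2]]) (r' & _ & Hr' & [[H3 H4]|[H3 H4]]).
  - destruct (no_2plus2 r q r' p); auto.
  - destruct (no_3plus1 r q r' p); auto.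
  - destruct (no_3plus1 r' p r q); auto.
  - destruct (no_2plus2 p r q r'); auto.
Qed.

Lemma before_cotrans k p q s : before k p q -> before k p s \/ before k s q.
Proof.
  intros (r & L & Hr & [[H1 H2]|[H1 H2]]).
  - destruct (classic (prec r s)); [left|right]; now apply before_lower with r.
  - destruct (classic (prec s r)); [right|left]; now apply before_upper with r.
Qed.

(** A point of the line is described by the sets [U], of the elements whose interval does
    not lie entirely to its left, and [V], of those whose interval lies entirely to its right. *)
Definition legit (k : M) (U V : M -> Prop) : Prop := forall p q,
  p < k -> q < k -> P p -> P q ->
  (V p -> U p) /\ (prec p q -> U p -> V q) /\ (~ U p -> V q -> prec p q) /\
  (U p -> ~ U q -> before k q p) /\ (V p -> ~ V q -> before k q p).

Lemma legit_left_end n p : P p -> p < n -> legit n (fun z => ~ prec z p) (before n p).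
Proof.
  intros Hp Hn z q Hz Hq Pz Pq. repeat split.
  - intros H H'. apply (before_asym _ n _ _ Hp Pz H). now apply before_lower with z.
  - intros H H'. now apply before_lower with z.
  - intros H H'. apply NNPP in H. apply NNPP. intros H0.
    apply (before_asym _ n _ _ Hp Pq H'). now apply before_lower with z.
  - intros H H'. apply NNPP in H'. now apply before_upper with p.
  - intros H H'. now destruct (before_cotrans n p z q H).
Qed.

Lemma legit_right_end n p : P p -> p < n -> legit n (fun z => ~ before n z p) (prec p).
Proof.
  intros Hp Hn z q Hz Hq Pz Pq. repeat split.
  - intros H H'. apply (before_asym _ n _ _ Pz Hp H'). now apply before_lower with p.
  - intros H H'. apply NNPP. intros H0. apply H'. now apply before_upper with q.
  - intros H H'. apply NNPP in H. apply NNPP. intros H0.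
    apply (before_asym _ n _ _ Pz Hp H). now apply before_upper with q.
  - intros H H'. apply NNPP in H'. now destruct (before_cotrans n q p z H').
  - intros H H'. now apply before_lower with p.
Qed.

(** The recursion gives [k] the leftmost status that its predecessors allow. *)
Lemma legit_step k (U V : M -> Prop) : legit k U V ->
  (P k -> (U k <-> exists p, p < k /\ P p /\
                   (V p /\ ~ prec k p \/ U p /\ ~ before (k + 1) k p)) /\
          (V k <-> exists p, p < k /\ P p /\
                   (U p /\ prec p k \/ V p /\ ~ before (k + 1) k p))) ->
  legit (k + 1) U V.
Proof.
  intros HL Hk p q Lp Lq Pp Pq. apply lt_S_r in Lp, Lq.
  assert (Lk := lt_S k).
  assert (old : forall z, z < k -> z < k + 1) by (intros; apply lt_S_r; auto).
  assert (HVU : P k -> V k -> U k).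
  { intros Pk H. apply Hk in H; [|exact Pk]. apply Hk; [exact Pk|].
    destruct H as (s & Ls & Ps & [[Us Hs]|[Vs Hs]]); exists s; repeat split; auto; right;
      (split; [|try exact Hs]).
    - exact Us.
    - intros Hb. apply (before_asym _ (k + 1) k s Pk Ps Hb). apply before_lower with s; auto.
    - now apply (HL s s Ls Ls Ps Ps). }
  destruct Lp as [Lp| ->], Lq as [Lq| ->].
  - destruct (HL p q Lp Lq Pp Pq) as (H1 & H2 & H3 & H4 & H5).
    repeat split; auto using before_mono.
  - destruct (Hk Pq) as [HU HV]. clear Hk.
    repeat split.
    + now apply (HL p p Lp Lp Pp Pp).
    + intros H H'. apply HV. exists p. auto.
    + intros Hp Hq. apply HV in Hq. destruct Hq as (s & Ls & Ps & [[Us Hs]|[Vs Hs]]).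
      * destruct (HL s p Ls Lp Ps Pp) as (_ & _ & _ & H4 & _).
        apply NNPP. intros H.
        apply (before_asym k (k + 1) p s Pp Ps); [auto|].
        now apply before_upper with k.
      * destruct (HL p s Lp Ls Pp Ps) as (_ & _ & H3 & _).
        apply NNPP. intros H. apply Hs. apply before_lower with p; auto.
    + intros Up Hq. apply NNPP. intros H. apply Hq, HU. exists p. auto.
    + intros Vp Hq. apply NNPP. intros H. apply Hq, HV. exists p. auto.
  - destruct (Hk Pp) as [HU HV]. clear Hk. repeat split.
    + auto.
    + intros Hkq H. apply HU in H. destruct H as (s & Ls & Ps & [[Vs Hs]|[Us Hs]]).
      * destruct (HL s q Ls Lq Ps Pq) as (_ & _ & _ & _ & H5).
        apply NNPP. intros Hq.
        apply (before_asym k (k + 1) q s Pq Ps); [auto|].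
        now apply before_lower with k.
      * destruct (HL s q Ls Lq Ps Pq) as (_ & H2 & _).
        apply H2; [|exact Us]. apply NNPP. intros H. apply Hs.
        apply before_upper with q; auto.
    + intros Hkn Vq. apply NNPP. intros H. apply Hkn, HU. exists q. auto.
    + intros H Hq. apply HU in H. destruct H as (s & Ls & Ps & [[Vs Hs]|[Us Hs]]).
      * destruct (HL q s Lq Ls Pq Ps) as (_ & _ & H3 & _).
        apply before_upper with s; auto.
      * destruct (HL s q Ls Lq Ps Pq) as (_ & _ & _ & H4 & _).
        now destruct (before_cotrans (k + 1) q s k (before_mono _ _ _ (H4 Us Hq))).
    + intros H Hq. apply HV in H. destruct H as (s & Ls & Ps & [[Us Hs]|[Vs Hs]]).
      * destruct (HL s q Ls Lq Ps Pq) as (_ & H2 & _).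
        apply before_lower with s; auto.
      * destruct (HL s q Ls Lq Ps Pq) as (_ & _ & _ & _ & H5).
        now destruct (before_cotrans (k + 1) q s k (before_mono _ _ _ (H5 Vs Hq))).
  - repeat split; try (intros; tauto).
    intros H. now apply prec_irrefl in H.
Qed.

Lemma legit_comparable k U V U' V' z z' : legit k U V -> legit k U' V' ->
  z < k -> z' < k -> P z -> P z' ->
  U z /\ ~ U' z \/ V z /\ ~ V' z -> U' z' /\ ~ U z' \/ V' z' /\ ~ V z' -> False.
Proof.
  intros H H' Lz Lz' Pz Pz'.
  destruct (H z z' Lz Lz' Pz Pz') as (_ & A2 & _ & A4 & A5).
  destruct (H z' z Lz' Lz Pz' Pz) as (_ & _ & B3 & _).
  destruct (H' z' z Lz' Lz Pz' Pz) as (_ & A2' & _ & A4' & A5').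
  destruct (H' z z' Lz Lz' Pz Pz') as (_ & _ & B3' & _).
  intros [[E1 E2]|[E1 E2]] [[E3 E4]|[E3 E4]]; auto.
  - apply (before_asym k k z z' Pz Pz'); auto.
  - apply (before_asym k k z z' Pz Pz'); auto.
Qed.

End Semiorder.

(** * The representation *)

Section Construction.

Variables P R : sets M.
Hypothesis R_irrefl : forall p, ~ ⟨p, p⟩ ∈ R.
Hypothesis R_2plus2 : forall p0 q0 p1 q1, p0 ∈ P -> q0 ∈ P -> p1 ∈ P -> q1 ∈ P ->
  ⟨p0, q0⟩ ∈ R -> ⟨p1, q1⟩ ∈ R -> ⟨p0, q1⟩ ∈ R \/ ⟨p1, q0⟩ ∈ R.
Hypothesis R_3plus1 : forall p0 p1 p2 q, p0 ∈ P -> p1 ∈ P -> p2 ∈ P -> q ∈ P ->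
  ⟨p0, p1⟩ ∈ R -> ⟨p1, p2⟩ ∈ R -> ⟨p0, q⟩ ∈ R \/ ⟨q, p2⟩ ∈ R.

Let inP (p : M) : Prop := p ∈ P.
Let prec (p q : M) : Prop := ⟨p, q⟩ ∈ R.
Let bef : M -> M -> M -> Prop := before inP prec.

(** [left_point n p] and [right_point n p] name the last point known at stage [n] to begin,
    and the first point known to end, an interval that at stage [n] looks like that of [p]. *)
Definition left_point (n p : M) : M := ⟨⟨n, p⟩, 0⟩.
Definition right_point (n p : M) : M := ⟨⟨n, p⟩, 1⟩.
Definition is_point (x n p : M) : Prop := x = left_point n p \/ x = right_point n p.

Lemma zero_neq_one : (0 : M) <> 1.
Proof. intros H. apply (succ_nonzero 0). rewrite add_0_l. now symmetry. Qed.

Lemma is_point_inj x n p n' p' : is_point x n p -> is_point x n' p' -> n = n' /\ p = p'.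
Proof.
  intros [-> | ->] [H|H]; apply pair_inj in H; destruct H as [H _]; now apply pair_inj in H.
Qed.

Lemma is_point_bounds x n p : is_point x n p -> n < x + 1 /\ p < x + 1.
Proof.
  intros [-> | ->]; split; (eapply le_trans_S; [|apply pair_le_l]);
    apply pair_le_l || apply pair_le_r.
Qed.

Lemma bef_set : exists W, forall k p q, ⟨⟨k, p⟩, q⟩ ∈ W <-> bef k p q.
Proof.
  apply (delta0_comprehension3
    (BEx #1 (Mem #0 0 //\\ ((Rel 1 #0 #3 //\\ Neg (Rel 1 #0 #1)) \\//
                            (Rel 1 #1 #0 //\\ Neg (Rel 1 #3 #0))))) r0 (P .: R .: e0)).
  solve_delta0.
Qed.

Lemma cuts_ex : exists U V, forall x n p, is_point x n p ->
  (forall z, z < n ->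
    (x = left_point n p -> (⟨x, z⟩ ∈ U <-> ~ prec z p) /\ (⟨x, z⟩ ∈ V <-> bef n p z)) /\
    (x = right_point n p -> (⟨x, z⟩ ∈ U <-> ~ bef n z p) /\ (⟨x, z⟩ ∈ V <-> prec p z))) /\
  (forall z, ~ z < n ->
    (⟨x, z⟩ ∈ U <-> exists s, s < z /\ inP s /\
       (⟨x, s⟩ ∈ V /\ ~ prec z s \/ ⟨x, s⟩ ∈ U /\ ~ bef (z + 1) z s)) /\
    (⟨x, z⟩ ∈ V <-> exists s, s < z /\ inP s /\
       (⟨x, s⟩ ∈ U /\ prec s z \/ ⟨x, s⟩ ∈ V /\ ~ bef (z + 1) z s))).
Proof.
  destruct bef_set as [W HW].
  destruct (delta0_comprehension2
    (BEx (Succ #1) (BEx (Succ #2) (Lt #2 #1 //\\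
      ((Eq #3 (npair (npair #1 #0) Zero) //\\ Neg (Rel 0 #2 #0)) \\//
       (Eq #3 (npair (npair #1 #0) One) //\\ Neg (Mem (npair (npair #1 #2) #0) 1))))))
    r0 (R .: W .: e0)) as [BU HBU]; [solve_delta0|]. cbn in HBU.
  destruct (delta0_comprehension2
    (BEx (Succ #1) (BEx (Succ #2) (Lt #2 #1 //\\
      ((Eq #3 (npair (npair #1 #0) Zero) //\\ Mem (npair (npair #1 #0) #2) 1) \\//
       (Eq #3 (npair (npair #1 #0) One) //\\ Rel 0 #0 #2)))))
    r0 (R .: W .: e0)) as [BV HBV]; [solve_delta0|]. cbn in HBV.
  destruct (delta0_comprehension2
    (BEx (Succ #1) (BEx (Succ #2) (Lt #2 #1 //\\
      (Eq #3 (npair (npair #1 #0) Zero) \\// Eq #3 (npair (npair #1 #0) One)))))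
    r0 e0) as [D HD]; [solve_delta0|]. cbn in HD.
  destruct (delta0_comprehension2 (Mem #0 0 //\\ Neg (Rel 1 #1 #0)) r0 (P .: R .: e0))
    as [H1 HH1]; [solve_delta0|]. cbn in HH1.
  destruct (delta0_comprehension2
    (Mem #0 0 //\\ Neg (Mem (npair (npair (Succ #1) #1) #0) 1)) r0 (P .: W .: e0))
    as [H2 HH2]; [solve_delta0|]. cbn in HH2.
  destruct (delta0_comprehension2 (Mem #0 0 //\\ Rel 1 #0 #1) r0 (P .: R .: e0))
    as [H3 HH3]; [solve_delta0|]. cbn in HH3.
  destruct (simultaneous_recursion BU BV D H1 H2 H3) as (U & V & HUV).
  exists U, V. intros x n p Hx. destruct (is_point_bounds x n p Hx) as [Ln Lp].
  assert (HDx : forall z, ⟨x, z⟩ ∈ D <-> z < n).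
  { intros z. rewrite HD. split.
    - intros (n' & _ & p' & _ & L & H). destruct (is_point_inj x n p n' p' Hx H) as [-> ->].
      exact L.
    - intros L. exists n. split; [exact Ln|]. exists p. auto. }
  split; intros z Hz; destruct (HUV x z) as [HU HV]; rewrite HDx in HU, HV.
  - assert (HU' : ⟨x, z⟩ ∈ U <-> ⟨x, z⟩ ∈ BU) by (rewrite HU; tauto).
    assert (HV' : ⟨x, z⟩ ∈ V <-> ⟨x, z⟩ ∈ BV) by (rewrite HV; tauto).
    split; intros E; rewrite HU', HV', HBU, HBV; split; (split;
      [intros (n' & _ & p' & _ & _ & [[E' H]|[E' H]]);
       rewrite E in E'; apply pair_inj in E'; destruct E' as [E' E''];
       try (now destruct zero_neq_one); apply pair_inj in E'; destruct E' as [<- <-];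
       rewrite <- ?HW; exact H
      |intros H; exists n; split; [exact Ln|]; exists p; split; [exact Lp|];
       split; [exact Hz|]; rewrite <- ?HW in H; auto]).
  - assert (HBUx : ~ ⟨x, z⟩ ∈ BU).
    { rewrite HBU. intros (n' & _ & p' & _ & L & H). apply Hz.
      destruct (is_point_inj x n p n' p' Hx) as [-> _]; [|exact L].
      destruct H as [[H _]|[H _]]; [left|right]; exact H. }
    assert (HBVx : ~ ⟨x, z⟩ ∈ BV).
    { rewrite HBV. intros (n' & _ & p' & _ & L & H). apply Hz.
      destruct (is_point_inj x n p n' p' Hx) as [-> _]; [|exact L].
      destruct H as [[H _]|[H _]]; [left|right]; exact H. }
    rewrite HU, HV. split; (split;
      [intros [H|(_ & s & L & H)]; [easy|]
      |intros (s & L & H); right; split; [exact Hz|]]); exists s; (split; [exact L|]);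
      rewrite HH2, ?HH1, ?HH3, HW in *; unfold inP, prec; tauto.
Qed.

Section Line.

Variables U V : sets M.
Hypothesis cut_start : forall x n p, is_point x n p -> forall z, z < n ->
  (x = left_point n p -> (⟨x, z⟩ ∈ U <-> ~ prec z p) /\ (⟨x, z⟩ ∈ V <-> bef n p z)) /\
  (x = right_point n p -> (⟨x, z⟩ ∈ U <-> ~ bef n z p) /\ (⟨x, z⟩ ∈ V <-> prec p z)).
Hypothesis cut_next : forall x n p, is_point x n p -> forall z, ~ z < n ->
  (⟨x, z⟩ ∈ U <-> exists s, s < z /\ inP s /\
     (⟨x, s⟩ ∈ V /\ ~ prec z s \/ ⟨x, s⟩ ∈ U /\ ~ bef (z + 1) z s)) /\
  (⟨x, z⟩ ∈ V <-> exists s, s < z /\ inP s /\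
     (⟨x, s⟩ ∈ U /\ prec s z \/ ⟨x, s⟩ ∈ V /\ ~ bef (z + 1) z s)).

Definition point (x : M) : Prop := exists n p, p ∈ P /\ p < n /\ is_point x n p.

Definition Ucut (x z : M) : Prop := ⟨x, z⟩ ∈ U.
Definition Vcut (x z : M) : Prop := ⟨x, z⟩ ∈ V.

Lemma legit_ext k (U1 V1 U2 V2 : M -> Prop) :
  (forall z, z < k -> (U1 z <-> U2 z) /\ (V1 z <-> V2 z)) ->
  legit inP prec k U1 V1 -> legit inP prec k U2 V2.
Proof.
  intros H HL p q Lp Lq Pp Pq.
  destruct (HL p q Lp Lq Pp Pq) as (A1 & A2 & A3 & A4 & A5).
  destruct (H p Lp), (H q Lq). repeat split; tauto.
Qed.

Lemma point_legit x n p k : is_point x n p -> p ∈ P -> p < n -> ~ k < n ->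
  legit inP prec k (Ucut x) (Vcut x).
Proof.
  intros Hx Pp Lp Hk. apply not_lt in Hk. destruct Hk as [d ->].
  destruct bef_set as [W HW].
  destruct (delta0_comprehension
    (BAll (Add #1 #0) (BAll (Add #2 #1) (Mem #1 0 --> Mem #0 0 -->
      ((Rel 4 #4 #1 --> Rel 3 #4 #1) //\\
       (Rel 1 #1 #0 --> Rel 3 #4 #1 --> Rel 4 #4 #0) //\\
       (Neg (Rel 3 #4 #1) --> Rel 4 #4 #0 --> Rel 1 #1 #0) //\\
       (Rel 3 #4 #1 --> Neg (Rel 3 #4 #0) --> Mem (npair (npair (Add #3 #2) #0) #1) 2) //\\
       (Rel 4 #4 #1 --> Neg (Rel 4 #4 #0) --> Mem (npair (npair (Add #3 #2) #0) #1) 2)))))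
    (n .: x .: r0) (P .: R .: W .: U .: V .: e0)) as [X HX]; [solve_delta0|]. cbn in HX.
  assert (HX' : forall d, d ∈ X <-> legit inP prec (n + d) (Ucut x) (Vcut x)).
  { intros c. rewrite HX. unfold legit. split.
    - intros H a b La Lb Pa Pb. specialize (H a La b Lb Pa Pb).
      rewrite !HW in H. exact H.
    - intros H a La b Lb Pa Pb. specialize (H a b La Lb Pa Pb).
      rewrite !HW. exact H. }
  apply HX', set_ind; clear d.
  - apply HX'. rewrite add_0_r. destruct Hx as [Hx|Hx].
    + apply legit_ext with (2 := legit_left_end inP prec R_irrefl R_2plus2 R_3plus1 n p Pp Lp).
      intros z Lz. destruct (cut_start x n p (or_introl Hx) z Lz) as [H _].
      destruct (H Hx). split; now symmetry.
    + apply legit_ext with (2 := legit_right_end inP prec R_irrefl R_2plus2 R_3plus1 n p Pp Lp).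
      intros z Lz. destruct (cut_start x n p (or_intror Hx) z Lz) as [_ H].
      destruct (H Hx). split; now symmetry.
  - intros d Hd. apply HX' in Hd. apply HX'. rewrite add_assoc.
    apply legit_step; auto.
    intros _. apply (cut_next x n p Hx). apply not_lt. now exists d.
Qed.

(** The element [z] witnesses that the point [x] lies to the left of the point [y]. *)
Definition drop (x y z : M) : Prop := Ucut x z /\ ~ Ucut y z \/ Vcut x z /\ ~ Vcut y z.

Lemma point_comparable x y z z' : point x -> point y -> z ∈ P -> z' ∈ P ->
  drop x y z -> drop y x z' -> False.
Proof.
  intros (n & p & Pp & Lp & Hx) (m & q & Pq & Lq & Hy) Pz Pz' H H'.
  destruct (lt_bounds n m) as (k1 & L1 & L2), (lt_bounds z z') as (k2 & L3 & L4).
  destruct (lt_bounds k1 k2) as (k & L5 & L6).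
  assert (Hk : forall i, i < k1 \/ i < k2 -> i < k).
  { intros i [Hi|Hi]; [now apply lt_trans with k1|now apply lt_trans with k2]. }
  apply (legit_comparable inP prec R_2plus2 R_3plus1 k
           (Ucut x) (Vcut x) (Ucut y) (Vcut y) z z'); auto.
  - apply (point_legit x n p); auto. apply lt_asym; auto.
  - apply (point_legit y m q); auto. apply lt_asym; auto.
Qed.

Lemma point_le_sum x y n p : is_point x n p -> ~ x + y < n.
Proof.
  intros Hx L. destruct (is_point_bounds x n p Hx) as [Ln _].
  apply (lt_irrefl (x + y)). apply lt_lt_S with n; [exact L|].
  apply le_trans_S with x; [exact Ln|]. apply lt_S_iff. now exists y.
Qed.

(** Beyond the stages of both points the cuts are continued by the same rule, so the order
    of the points is decided by a bounded search. *)
Lemma point_agree x y : point x -> point y ->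
  (forall z, z < x + y -> z ∈ P -> ~ drop x y z /\ ~ drop y x z) ->
  forall z, z ∈ P -> (Ucut x z <-> Ucut y z) /\ (Vcut x z <-> Vcut y z).
Proof.
  intros (n & p & Pp & Lp & Hx) (m & q & Pq & Lq & Hy) H.
  destruct (delta0_comprehension
    (Mem #0 0 --> (Rel 1 #1 #0 <--> Rel 1 #2 #0) //\\ (Rel 2 #1 #0 <--> Rel 2 #2 #0))
    (x .: y .: r0) (P .: U .: V .: e0)) as [X HX]; [solve_delta0|]. cbn in HX.
  intros z. apply (HX z), set_strong_ind. clear z. intros z IH. apply HX. intros Pz.
  assert (IH' : forall s, s < z -> inP s ->
            (⟨x, s⟩ ∈ U <-> ⟨y, s⟩ ∈ U) /\ (⟨x, s⟩ ∈ V <-> ⟨y, s⟩ ∈ V)).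
  { intros s Ls Ps. now apply (HX s); [apply IH|]. }
  change ((Ucut x z <-> Ucut y z) /\ (Vcut x z <-> Vcut y z)).
  destruct (classic (z < x + y)) as [L|L].
  - specialize (H z L Pz). unfold drop in H. tauto.
  - destruct (cut_next x n p Hx z) as [HUx HVx].
    { intros L'. apply (point_le_sum x y n p Hx). now apply le_lt_trans with z. }
    destruct (cut_next y m q Hy z) as [HUy HVy].
    { intros L'. apply (point_le_sum y x m q Hy). rewrite add_comm.
      now apply le_lt_trans with z. }
    unfold Ucut, Vcut. rewrite HUx, HVx, HUy, HVy.
    split; split; intros (s & Ls & Ps & Hs); exists s; specialize (IH' s Ls Ps); tauto.
Qed.

Definition dropped (x y : M) : Prop := exists z, z ∈ P /\ drop x y z.

Lemma dropped_asym x y : point x -> point y -> dropped x y -> ~ dropped y x.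
Proof. intros Hx Hy (z & Pz & H) (z' & Pz' & H'). now apply (point_comparable x y z z'). Qed.

Lemma dropped_bounded x y : point x -> point y ->
  (exists z, z < x + y /\ z ∈ P /\ drop x y z) <-> dropped x y.
Proof.
  intros Hx Hy. split; [intros (z & _ & H); now exists z|].
  intros H. apply NNPP. intros Hn.
  assert (Hag : forall z, z < x + y -> z ∈ P -> ~ drop x y z /\ ~ drop y x z).
  { intros z Lz Pz. split; intros Hd.
    - apply Hn. now exists z.
    - apply (dropped_asym x y Hx Hy H). now exists z. }
  destruct H as (z & Pz & H). pose proof (point_agree x y Hx Hy Hag z Pz).
  unfold drop in H. tauto.
Qed.

Lemma dropped_cotrans x y z : dropped x y -> dropped x z \/ dropped z y.
Proof.
  intros (w & Pw & H).
  destruct (classic (drop x z w)) as [H1|H1]; [left|right]; exists w; (split; [exact Pw|]);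
    [exact H1|]. unfold drop in *. tauto.
Qed.

Lemma not_dropped_mono x y p : p ∈ P -> ~ dropped y x ->
  (Ucut y p -> Ucut x p) /\ (Vcut y p -> Vcut x p).
Proof.
  intros Pp H. split; intros H'; apply NNPP; intros Hn; apply H; exists p; unfold drop; tauto.
Qed.

Lemma point_legit_large x p q : point x ->
  exists k, p < k /\ q < k /\ legit inP prec k (Ucut x) (Vcut x).
Proof.
  intros (n & s & Ps & Ls & Hx).
  destruct (lt_bounds p q) as (k1 & L1 & L2), (lt_bounds n k1) as (k & L3 & L4).
  exists k. split; [now apply lt_trans with k1|]. split; [now apply lt_trans with k1|].
  apply (point_legit x n s); auto. now apply lt_asym.
Qed.

Definition inside (p x : M) : Prop := p ∈ P /\ point x /\ Ucut x p /\ ~ Vcut x p.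

Lemma bef_irrefl n p : p ∈ P -> ~ bef n p p.
Proof.
  intros Pp H. now apply (before_asym inP prec R_2plus2 R_3plus1 n n p p).
Qed.

Lemma left_point_point n p : p ∈ P -> p < n -> point (left_point n p).
Proof. intros. exists n, p. split; [|split]; auto. now left. Qed.

Lemma right_point_point n p : p ∈ P -> p < n -> point (right_point n p).
Proof. intros. exists n, p. split; [|split]; auto. now right. Qed.

Lemma left_point_cut n p z : z < n ->
  (Ucut (left_point n p) z <-> ~ prec z p) /\ (Vcut (left_point n p) z <-> bef n p z).
Proof. intros L. now apply (cut_start (left_point n p) n p); [left| |]. Qed.

Lemma right_point_cut n p z : z < n ->
  (Ucut (right_point n p) z <-> ~ bef n z p) /\ (Vcut (right_point n p) z <-> prec p z).
Proof. intros L. now apply (cut_start (right_point n p) n p); [right| |]. Qed.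

Lemma inside_left_point n p q : p ∈ P -> q ∈ P -> p < n -> q < n ->
  (inside q (left_point n p) <-> ~ prec q p /\ ~ bef n p q).
Proof.
  intros Pp Pq Lp Lq. destruct (left_point_cut n p q Lq) as [HU HV].
  assert (Hpt := left_point_point n p Pp Lp).
  unfold inside. rewrite HU, HV. tauto.
Qed.

Lemma inside_right_point n p q : p ∈ P -> q ∈ P -> p < n -> q < n ->
  (inside q (right_point n p) <-> ~ bef n q p /\ ~ prec p q).
Proof.
  intros Pp Pq Lp Lq. destruct (right_point_cut n p q Lq) as [HU HV].
  assert (Hpt := right_point_point n p Pp Lp).
  unfold inside. rewrite HU, HV. tauto.
Qed.

Lemma inside_nonempty p : p ∈ P -> exists x, inside p x.
Proof.
  intros Pp. exists (left_point (p + 1) p).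
  apply inside_left_point; auto using lt_S. split; [apply R_irrefl|now apply bef_irrefl].
Qed.

Lemma inside_common p q : p ∈ P -> q ∈ P -> ~ prec p q -> ~ prec q p ->
  exists x, inside p x /\ inside q x.
Proof.
  intros Pp Pq Hpq Hqp. destruct (lt_bounds p q) as (n & Lp & Lq).
  destruct (classic (bef n q p)) as [H|H].
  - exists (left_point n p).
    rewrite !inside_left_point by assumption.
    pose proof (R_irrefl p). pose proof (bef_irrefl n p Pp).
    pose proof (before_asym inP prec R_2plus2 R_3plus1 n n q p Pq Pp H). auto.
  - exists (left_point n q).
    rewrite !inside_left_point by assumption.
    pose proof (R_irrefl q). pose proof (bef_irrefl n q Pq). auto.
Qed.

Lemma inside_prec p q x y : prec p q -> inside p x -> inside q y -> dropped x y.
Proof.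
  intros Hpq (Pp & Hx & Ux & _) (Pq & _ & _ & Vy).
  exists q. split; [exact Pq|]. right. split; [|exact Vy].
  destruct (point_legit_large x p q Hx) as (k & Lp & Lq & HL).
  now apply (HL p q Lp Lq Pp Pq).
Qed.

Lemma inside_no_inclusion p q : p ∈ P -> q ∈ P ->
  (forall x, inside p x -> inside q x) -> forall x, inside q x -> inside p x.
Proof.
  intros Pp Pq H x (_ & Hx & Ux & Vx).
  destruct (point_legit_large x p q Hx) as (k & Lp & Lq & HL).
  destruct (HL q p Lq Lp Pq Pp) as (_ & _ & _ & H4 & _).
  destruct (HL p q Lp Lq Pp Pq) as (_ & _ & _ & _ & H5).
  repeat split; auto.
  - apply NNPP. intros Hn. apply H4 in Hn; [|exact Ux].
    assert (Hp : inside q (left_point k p)).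
    { apply H, inside_left_point; auto. split; [apply R_irrefl|now apply bef_irrefl]. }
    now apply inside_left_point in Hp.
  - intros Hn. apply H5 in Hn; [|exact Vx].
    assert (Hp : inside q (right_point k p)).
    { apply H, inside_right_point; auto. split; [now apply bef_irrefl|apply R_irrefl]. }
    now apply inside_right_point in Hp.
Qed.

End Line.

Lemma representation : exists L S F,
  (forall z, z ∈ S -> exists x y, z = ⟨x, y⟩ /\ x ∈ L /\ y ∈ L) /\
  (forall x, x ∈ L -> ⟨x, x⟩ ∈ S) /\
  (forall x y z, x ∈ L -> y ∈ L -> z ∈ L -> ⟨x, y⟩ ∈ S -> ⟨y, z⟩ ∈ S -> ⟨x, z⟩ ∈ S) /\
  (forall x y, x ∈ L -> y ∈ L -> ⟨x, y⟩ ∈ S -> ⟨y, x⟩ ∈ S -> x = y) /\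
  (forall x y, x ∈ L -> y ∈ L -> ⟨x, y⟩ ∈ S \/ ⟨y, x⟩ ∈ S) /\
  (forall z, z ∈ F -> exists p x, z = ⟨p, x⟩ /\ p ∈ P /\ x ∈ L) /\
  (forall p, p ∈ P -> exists x, x ∈ L /\ ⟨p, x⟩ ∈ F) /\
  (forall p x y z, z ∈ L -> ⟨p, x⟩ ∈ F -> ⟨p, y⟩ ∈ F -> ⟨x, z⟩ ∈ S -> ⟨z, y⟩ ∈ S ->
     ⟨p, z⟩ ∈ F) /\
  (forall p q, p ∈ P -> q ∈ P -> ⟨p, q⟩ ∈ R <->
     forall x y, x ∈ L -> y ∈ L -> ⟨p, x⟩ ∈ F -> ⟨q, y⟩ ∈ F -> ⟨x, y⟩ ∈ S /\ x <> y) /\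
  (forall p q, p ∈ P -> q ∈ P -> (forall x, x ∈ L -> ⟨p, x⟩ ∈ F -> ⟨q, x⟩ ∈ F) ->
     forall x, x ∈ L -> ⟨q, x⟩ ∈ F -> ⟨p, x⟩ ∈ F).
Proof.
  destruct cuts_ex as (U & V & HUV).
  assert (start := fun x n p Hx => proj1 (HUV x n p Hx)).
  assert (next := fun x n p Hx => proj2 (HUV x n p Hx)). clear HUV.
  destruct (delta0_comprehension
    (BEx (Succ #0) (BEx (Succ #1) (Mem #0 0 //\\ Lt #0 #1 //\\
      (Eq #2 (npair (npair #1 #0) Zero) \\// Eq #2 (npair (npair #1 #0) One)))))
    r0 (P .: e0)) as [L HL]; [solve_delta0|].
  assert (HL' : forall x, x ∈ L <-> point x).
  { intros x. rewrite HL. cbn. split.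
    - intros (n & _ & p & _ & H). now exists n, p.
    - intros (n & p & H). destruct (is_point_bounds x n p) as [Ln Lp]; [apply H|].
      exists n. split; [exact Ln|]. exists p. split; [exact Lp|exact H]. }
  clear HL. rename HL' into HL.
  destruct (delta0_comprehension2
    (BEx (Add #1 #0) (Mem #0 0 //\\ ((Rel 1 #2 #0 //\\ Neg (Rel 1 #1 #0)) \\//
                                    (Rel 2 #2 #0 //\\ Neg (Rel 2 #1 #0)))))
    r0 (P .: U .: V .: e0)) as [D HD]; [solve_delta0|].
  assert (HD' : forall x y, point x -> point y -> (⟨x, y⟩ ∈ D <-> dropped U V x y)).
  { intros x y Hx Hy. rewrite HD.
    exact (dropped_bounded U V start next x y Hx Hy). }
  clear HD. rename HD' into HD.
  destruct (delta0_comprehension_pairs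
    (Mem #1 0 //\\ Mem #0 0 //\\
      (Rel 1 #1 #0 \\// Neg (Rel 1 #0 #1) //\\ Lt #1 (Succ #0)))
    r0 (L .: D .: e0)) as (S & HS2 & HS); [solve_delta0|]. cbn in HS.
  assert (HS' : forall x y, x ∈ L -> y ∈ L -> (⟨x, y⟩ ∈ S <->
            dropped U V x y \/ ~ dropped U V y x /\ x < y + 1)).
  { intros x y Hx Hy. rewrite HS, !HD by (now apply HL). tauto. }
  destruct (delta0_comprehension_pairs
    (Mem #1 0 //\\ Mem #0 1 //\\ Rel 2 #0 #1 //\\ Neg (Rel 3 #0 #1))
    r0 (P .: L .: U .: V .: e0)) as (F & HF2 & HF); [solve_delta0|]. cbn in HF.
  assert (HF' : forall p x, ⟨p, x⟩ ∈ F <-> inside U V p x).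
  { intros p x. rewrite HF, HL. reflexivity. }
  assert (asym : forall x y, x ∈ L -> y ∈ L -> dropped U V x y -> ~ dropped U V y x).
  { intros x y Hx Hy. apply (dropped_asym U V start next); now apply HL. }
  assert (mono : forall x y, ⟨x, y⟩ ∈ S -> ~ dropped U V y x).
  { intros x y H. assert (H' := proj1 (HS x y) H). destruct H' as (Hx & Hy & _).
    apply HS' in H; auto. destruct H as [H|[H _]]; [now apply asym|exact H]. }
  exists L, S, F. repeat split.
  - intros z Hz. destruct (HS2 z Hz) as (x & y & ->). exists x, y.
    apply HS in Hz. tauto.
  - intros x Hx. apply HS'; auto. right. split; [|apply lt_S].
    intros H. now apply (asym x x Hx Hx).
  - intros x y z Hx Hy Hz Hxy Hyz. assert (Mxy := mono _ _ Hxy). assert (Myz := mono _ _ Hyz).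
    apply HS' in Hxy, Hyz; auto. apply HS'; auto.
    destruct Hxy as [Hxy|[_ Lxy]].
    { left. now destruct (dropped_cotrans U V x y z Hxy). }
    destruct Hyz as [Hyz|[_ Lyz]].
    { left. now destruct (dropped_cotrans U V y z x Hyz). }
    right. split; [|now apply le_trans_S with y].
    intros H. now destruct (dropped_cotrans U V z x y H).
  - intros x y Hx Hy Hxy Hyx. assert (Mxy := mono _ _ Hxy). assert (Myx := mono _ _ Hyx).
    apply HS' in Hxy, Hyx; auto.
    destruct Hxy as [Hxy|[_ Lxy]]; [easy|]. destruct Hyx as [Hyx|[_ Lyx]]; [easy|].
    apply lt_S_r in Lxy. destruct Lxy as [Lxy|Lxy]; [|exact Lxy].
    apply lt_S_r in Lyx. destruct Lyx as [Lyx|Lyx]; [|now symmetry].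
    now apply lt_asym in Lxy.
  - intros x y Hx Hy. rewrite !HS' by auto. rewrite !lt_S_r.
    pose proof (lt_total x y). destruct (classic (dropped U V x y)), (classic (dropped U V y x));
      intuition auto.
  - intros z Hz. destruct (HF2 z Hz) as (p & x & ->). exists p, x.
    apply HF in Hz. tauto.
  - intros p Pp. destruct (inside_nonempty U V start p Pp) as [x Hx].
    exists x. split; [apply HL; apply Hx|now apply HF'].
  - intros p x y z Hz Hx Hy Hxz Hzy. apply HF' in Hx, Hy. apply HF'.
    destruct Hx as (Pp & _ & Ux & Vx), Hy as (_ & _ & Uy & Vy).
    destruct (not_dropped_mono U V x z p Pp (mono _ _ Hxz)) as [_ H1].
    destruct (not_dropped_mono U V z y p Pp (mono _ _ Hzy)) as [H2 _].
    repeat split; auto. now apply HL.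
  - apply HS'; auto. left. apply HF' in H4, H5.
    now apply (inside_prec U V start next p q x y).
  - intros <-. apply HF' in H4, H5.
    assert (Hd := inside_prec U V start next p q x x H1 H4 H5).
    now apply (asym x x H2 H2).
  - intros Hall. apply NNPP. intros Hpq.
    destruct (classic (⟨q, p⟩ ∈ R)) as [Hqp|Hqp].
    + destruct (inside_nonempty U V start p H) as [x Hx].
      destruct (inside_nonempty U V start q H0) as [y Hy].
      assert (Hd := inside_prec U V start next q p y x Hqp Hy Hx).
      destruct (Hall x y) as [Hxy _]; [apply HL; apply Hx|apply HL; apply Hy|now apply HF'..|].
      now apply (mono x y Hxy).
    + destruct (inside_common U V start p q H H0 Hpq Hqp) as (x & Hx & Hx').
      destruct (Hall x x) as [_ Hxx]; [apply HL; apply Hx|apply HL; apply Hx|now apply HF'..|].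
      now apply Hxx.
  - intros p q Pp Pq Hincl x Hx Hqx. apply HF'. apply HF' in Hqx.
    apply (inside_no_inclusion U V start next p q); auto.
    intros y Hy. apply HF', Hincl; [apply HL; apply Hy|now apply HF'].
Qed.

End Construction.

End Models.

Section StrictOrder.

Variable M : structure.
Hypothesis M_RCA0 : models M RCA0.
Variable R : sets M.

Local Open Scope num_scope.

Hypothesis R_trans : forall p q s, ⟨p, q⟩ ∈ R -> ⟨q, s⟩ ∈ R -> ⟨p, s⟩ ∈ R.
Hypothesis R_antisym : forall p q, ⟨p, q⟩ ∈ R -> ⟨q, p⟩ ∈ R -> p = q.

Lemma strict_2plus2 p0 q0 p1 q1 :
  (⟨p0, q0⟩ ∈ R /\ p0 <> q0 -> ⟨p1, q1⟩ ∈ R /\ p1 <> q1 ->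
     ⟨p0, q1⟩ ∈ R \/ ⟨p1, q0⟩ ∈ R) ->
  ⟨p0, q0⟩ ∈ R /\ p0 <> q0 -> ⟨p1, q1⟩ ∈ R /\ p1 <> q1 ->
  (⟨p0, q1⟩ ∈ R /\ p0 <> q1) \/ (⟨p1, q0⟩ ∈ R /\ p1 <> q0).
Proof.
  intros H [H0 N0] [H1 N1]. destruct H as [H2|H2]; [tauto..| |].
  - destruct (classic (p0 = q1)) as [->|N]; [right|now left].
    split; [now apply R_trans with q1|]. intros ->. now apply N0, R_antisym.
  - destruct (classic (p1 = q0)) as [->|N]; [left|now right].
    split; [now apply R_trans with q0|]. intros ->. now apply N0, R_antisym.
Qed.

Lemma strict_3plus1 p0 p1 p2 q :
  (⟨p0, p1⟩ ∈ R /\ p0 <> p1 -> ⟨p1, p2⟩ ∈ R /\ p1 <> p2 ->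
     ⟨p0, q⟩ ∈ R \/ ⟨q, p2⟩ ∈ R) ->
  ⟨p0, p1⟩ ∈ R /\ p0 <> p1 -> ⟨p1, p2⟩ ∈ R /\ p1 <> p2 ->
  (⟨p0, q⟩ ∈ R /\ p0 <> q) \/ (⟨q, p2⟩ ∈ R /\ q <> p2).
Proof.
  intros H [H0 N0] [H1 N1].
  assert (N : p0 <> p2) by (intros ->; now apply N1, R_antisym).
  assert (H02 : ⟨p0, p2⟩ ∈ R) by now apply R_trans with p1.
  destruct (classic (p0 = q)) as [<-|N2]; [now right|].
  destruct (classic (q = p2)) as [->|N3]; [now left|].
  destruct H; tauto.
Qed.

End StrictOrder.

Theorem theorem1p3 :
  provable RCA0
    (AllS (AllS
      (PartialOrder 1 0 -->
       (ProperIntervalOrder 1 0 <--> (No2plus2 1 0 //\\ No3plus1 1 0))))).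
Proof.
  apply completeness; [exact RCA0_closed|].
  intros M HM r e P R HPO. cbn in HPO.
  destruct HPO as (Rdom & _ & Rtrans & Ranti).
  assert (dom : forall p q, nmem ⟨p, q⟩%num R -> nmem p P /\ nmem q P).
  { intros p q H. destruct (Rdom _ H) as (p' & Hp & q' & Hq & E).
    apply pair_inj in E; auto. destruct E as [-> ->]. auto. }
  assert (trans : forall p q s, nmem ⟨p, q⟩%num R -> nmem ⟨q, s⟩%num R -> nmem ⟨p, s⟩%num R).
  { intros p q s H H'. destruct (dom _ _ H), (dom _ _ H'). now apply (Rtrans p) with q. }
  assert (anti : forall p q, nmem ⟨p, q⟩%num R -> nmem ⟨q, p⟩%num R -> p = q).
  { intros p q H H'. destruct (dom _ _ H). now apply Ranti. }
  clear Rdom Rtrans Ranti. split.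
  - cbn. intros (L & S & F & ((_ & _ & Strans & Santi) & Stot) & FPL & Fconv & Fprec & Fincl).
    assert (Fdom : forall p x, nmem ⟨p, x⟩%num F -> nmem p P /\ nmem x L).
    { intros p x H. destruct (FPL _ H) as (p' & Hp & x' & Hx & E).
      apply pair_inj in E; auto. destruct E as [-> ->]. auto. }
    set (lt x y := nmem ⟨x, y⟩%num S /\ (x = y -> False)).
    assert (lt_le : forall p q, nmem p P -> nmem q P -> ~ nmem ⟨p, q⟩%num R ->
              exists x y, nmem x L /\ nmem y L /\ nmem ⟨p, x⟩%num F /\ nmem ⟨q, y⟩%num F /\
                nmem ⟨y, x⟩%num S).
    { intros p q Pp Pq Hpq. apply NNPP. intros Hn.
      apply Hpq, (Fprec p Pp q Pq). intros x Lx y Ly Hx Hy.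
      assert (Hyx : ~ nmem ⟨y, x⟩%num S).
      { intros Hyx. apply Hn. exists x, y. auto. }
      destruct (Stot x Lx y Ly) as [H|H]; [|easy]. split; [exact H|].
      intros ->. easy. }
    assert (lt_trans1 : forall x y z, nmem x L -> nmem y L -> nmem z L ->
              lt x y -> nmem ⟨y, z⟩%num S -> lt x z).
    { intros x y z Lx Ly Lz [H N] H'. split; [now apply (Strans x Lx y Ly z Lz)|].
      intros ->. apply N. now apply Santi. }
    assert (lt_trans2 : forall x y z, nmem x L -> nmem y L -> nmem z L ->
              nmem ⟨x, y⟩%num S -> lt y z -> lt x z).
    { intros x y z Lx Ly Lz H [H' N]. split; [now apply (Strans x Lx y Ly z Lz)|].
      intros ->. apply N. now apply Santi. }
    split.
    + intros p0 P0 q0 Q0 p1 P1 q1 Q1 H0 H1. apply NNPP. intros Hn.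
      destruct (lt_le p0 q1) as (x0 & y1 & Lx0 & Ly1 & Hx0 & Hy1 & L1); auto.
      destruct (lt_le p1 q0) as (x1 & y0 & Lx1 & Ly0 & Hx1 & Hy0 & L2); auto.
      assert (E0 : lt x0 y0) by now apply (proj1 (Fprec p0 P0 q0 Q0) H0).
      assert (E1 : lt x1 y1) by now apply (proj1 (Fprec p1 P1 q1 Q1) H1).
      assert (E : lt x0 x0); [|now apply E].
      apply (lt_trans1 x0 y1); auto. apply (lt_trans2 x0 x1); auto.
      apply (lt_trans1 x0 y0); auto.
    + intros p0 P0 p1 P1 p2 P2 q Pq H0 H1. apply NNPP. intros Hn.
      destruct (lt_le p0 q) as (x0 & y & Lx0 & Ly & Hx0 & Hy & L1); auto.
      destruct (lt_le q p2) as (z & x2 & Lz & Lx2 & Hz & Hx2 & L2); auto.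
      assert (Hincl : forall w, nmem w L -> nmem ⟨p1, w⟩%num F -> nmem ⟨q, w⟩%num F).
      { intros w Lw Hw.
        assert (E0 : lt x0 w) by now apply (proj1 (Fprec p0 P0 p1 P1) H0).
        assert (E1 : lt w x2) by now apply (proj1 (Fprec p1 P1 p2 P2) H1).
        destruct (lt_trans2 y x0 w) as [E2 N2]; auto.
        destruct (lt_trans1 w x2 z) as [E3 N3]; auto.
        now apply (proj2 (Fconv q Pq) y Ly z Lz w Lw). }
      assert (Hy1 : nmem ⟨p1, y⟩%num F) by now apply (Fincl p1 P1 q Pq Hincl y Ly).
      assert (E : lt x0 x0); [|now apply E].
      apply (lt_trans1 x0 y); auto. now apply (proj1 (Fprec p0 P0 p1 P1) H0).
  - cbn. intros [H22 H31].
    destruct (delta0_comprehension2 M HM P (SRel 0 #1 #0) (fun _ => nzero M) (fun _ => R))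
      as [Q HQ]; [solve_delta0|]. cbn in HQ.
    destruct (representation M HM P P Q) as (L & S & F & Sdom & Srefl & Strans & Santi & Stot &
      Fdom & Fne & Fconv & Fprec & Fincl).
    + intros p H. apply HQ in H. tauto.
    + intros p0 q0 p1 q1 P0 Q0 P1 Q1. rewrite !HQ. apply strict_2plus2; auto.
    + intros p0 p1 p2 q P0 P1 P2 Pq. rewrite !HQ. apply strict_3plus1; auto. apply H31; auto.
    + exists L, S, F.
      split; [split; [split; [|split; [|split]]|]|split; [|split; [|split]]]; auto.
      * intros z Hz. destruct (Sdom z Hz) as (x & y & -> & Hx & Hy).
        exists x. split; [exact Hx|]. now exists y.
      * intros x Lx y Ly z Lz. now apply Strans.
      * intros z Hz. destruct (Fdom z Hz) as (p & x & -> & Hp & Hx).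
        exists p. split; [exact Hp|]. now exists x.
      * intros p Pp. split; [now apply Fne|].
        intros x Lx y Ly z Lz Hx Hy [Hxz _] [Hzy _]. now apply Fconv with x y.
      * intros p Pp q Pq. split.
        -- intros H x Lx y Ly. apply (Fprec p q); auto. now apply HQ.
        -- intros H. apply HQ, Fprec; auto.
      * intros p Pp q Pq H x Lx. split; [now apply H|]. now apply Fincl.
Qed.
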